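(* Let $K$ be a field, $n=3$, $x=(x_1,x_2,x_3)$, and let $H\in K[x]^3$ be quartic homogeneous such that $\mathcal{J}H$ is nilpotent. If $\frac16\in K$, then $\mathcal{J}H$ is similar over $K$ to a triangular matrix, and $\operatorname{rk}\mathcal{J}H=\operatorname{trdeg}_K K(H)$.
   Context: $\mathcal{J}H=(\partial H_i/\partial x_j)_{i,j}$ is the Jacobian matrix with respect to $x$, $\operatorname{rk}$ is the rank over $K(x)$, and $\operatorname{trdeg}_K K(H)$ is the transcendence degree over $K$ of the field generated by the components of $H$. Quartic homogeneous means that every nonzero component is homogeneous of degree $4$. $\frac16\in K$ means that the characteristic of $K$ is neither $2$ nor $3$. A matrix $M$ over $K(x)$ is similar over $K$ to $\tilde M$ if $\tilde M=T^{-1}MT$ for some $T\in\operatorname{GL}_n(K)$. *)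

(* Defs.v *)
From HB Require Import structures.
From mathcomp Require Import all_boot all_algebra.
From mathcomp Require Export mpoly.

Set Implicit Arguments.
Unset Strict Implicit.
Unset Printing Implicit Defensive.

Import GRing.Theory.
Local Open Scope ring_scope.

Notation ratfun K n := {fraction {mpoly K[n]}}.

Section Jacobian.
Variables (K : fieldType) (n : nat).

Definition ratfunC (c : K) : ratfun K n := tofrac c%:MP_[n].

HB.instance Definition _ := GRing.RMorphism.copy ratfunC
  (@tofrac {mpoly K[n]} \o @mpolyC n K).

Definition jacobian m (H : 'I_m -> {mpoly K[n]}) : 'M[ratfun K n]_(m, n) :=
  \matrix_(i < m, j < n) tofrac ((H i)^`M(j)).

Definition similar_over (m : nat) (M M' : 'M[ratfun K n]_m) : Prop :=
  exists2 T : 'M[K]_m, T \in unitmx &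
    M' = invmx (map_mx ratfunC T) *m M *m map_mx ratfunC T.

(* [is_trig_mx] only recognises lower triangular matrices. *)
Definition triangular_mx (R : nzRingType) (m : nat) (M : 'M[R]_m) : bool :=
  is_trig_mx M || is_trig_mx M^T.

End Jacobian.

Section TranscendenceDegree.
Variables (K L : fieldType) (iota : {rmorphism K -> L}).

Inductive adjoin (S : L -> Prop) : L -> Prop :=
  | adjoin_base c : adjoin S (iota c)
  | adjoin_gen a : S a -> adjoin S a
  | adjoin_add a b : adjoin S a -> adjoin S b -> adjoin S (a + b)
  | adjoin_opp a : adjoin S a -> adjoin S (- a)
  | adjoin_mul a b : adjoin S a -> adjoin S b -> adjoin S (a * b)
  | adjoin_inv a : adjoin S a -> adjoin S a^-1.

Definition adjoin_family d (a : 'I_d -> L) : L -> Prop :=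
  adjoin (fun b => exists i, b = a i).

Definition algebraic_over (F : L -> Prop) (b : L) : Prop :=
  exists p : {poly L}, [/\ p != 0, forall i, F p`_i & root p b].

Definition alg_independent d (a : 'I_d -> L) : Prop :=
  forall p : {mpoly K[d]}, mmap iota a p = 0 -> p = 0.

Definition transcendence_basis (E : L -> Prop) d (a : 'I_d -> L) : Prop :=
  [/\ forall i, E (a i),
      alg_independent a &
      forall b, E b -> algebraic_over (adjoin_family a) b].

(* All transcendence bases of E over K have the same cardinality, so this
   relation determines d. *)
Definition is_trdeg (E : L -> Prop) (d : nat) : Prop :=
  exists a : 'I_d -> L, transcendence_basis E a.

End TranscendenceDegree.

(* Main.v *)
Require Import Defs.
From mathcomp Require Import all_boot all_order all_algebra.
From mathcomp Require Import ring zify.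

Set Implicit Arguments.
Unset Strict Implicit.
Unset Printing Implicit Defensive.

Import Order.TTheory GRing.Theory.
Local Open Scope ring_scope.

(** Write J for the Jacobian, x for the vector of variables and L for lam . x
    below.  Since J is nilpotent, adj J = J^2, and if J has rank 2 then
    adj J = u lam^T with lam primitive.  Euler's formula turns this into
      4 cross(H, d_l H) = f om_l lam,  cross(lam, d_l lam) = sig om_l H1,
    where cross(u, x) = f om and H = h H1 with om and H1 primitive.  Moreover
      4 h (H1 . om) (L d_l H - 4 lam_l H) = L^2 om_l u,
    and comparing divisors yields L^2 | h^2 (H1 . om).  The degrees of these
    three relations leave only deg H1 = 2 and deg om = 1, so om = cross(c, x) with c
    constant, which forces H1 to be parallel to c.  Hence the components of H
    are always linearly dependent over K, and J reduces to a nilpotent 2 x 2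
    Jacobian, whose kernel direction is constant for a similar degree reason.
    The argument by divisibility is insensitive to inseparability, which in
    characteristic p > 3 is the difficulty: rank 2 does not by itself bound
    the transcendence degree by 2. *)

(** * Greatest common divisors of polynomials *)

(** Let dl, d and e be the degrees of lam, H1 and om. All derivatives of H1 are orthogonal to lam,
    so H1 and lam play symmetric roles: each is, up to a factor, the cross product of the other with
    its derivative. If both factors are nonzero, degrees give e + d <= 2 dl - 1 and e + dl <= 2 d -
    1, and the divisibility by L^2 gives 2 (dl + 1) <= 2 (4 - d) + d + e. Since e >= 1, the only
    solution is d = dl = 2, e = 1. Degrees cannot exclude it, so that case is settled by
    differentiating along c. If sig = 0, every derivative of lam vanishes; in characteristic p this
    does not make lam constant, and a relation over K is read off from its coefficients instead. The
    only integers that have to be invertible are 1, 2, 3, 4 and powers of 2, whence the hypothesis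
    on 1/6. For the second claim, rank and transcendence degree are never compared directly: once
    the components span a space of dimension at most 2 over K, both numbers turn out to be that
    dimension. *)

Section Primitive.
Variable R : idomainType.

Definition divides (a b : R) := exists q, b = a * q.

(** The multiplier [b] builds Euclid's lemma into coprimality, so that factors can be cancelled
    without prime factorization. The case [a = 0] makes the family nonzero. *)
Definition primitive (I : finType) (v : I -> R) :=
  forall a b, (forall i, divides a (b * v i)) -> divides a b.

Lemma dividesMr a b c : divides a b -> divides a (b * c).
Proof. by case=> q ->; exists (q * c); rewrite mulrA. Qed.

Lemma dividesMl a b c : divides a b -> divides a (c * b).
Proof. by rewrite mulrC; exact: dividesMr. Qed.

Lemma dividesD a b c : divides a b -> divides a c -> divides a (b + c).
Proof. by move=> [p ->] [q ->]; exists (p + q); rewrite mulrDr. Qed.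

Lemma dividesB a b c : divides a b -> divides a c -> divides a (b - c).
Proof. by move=> [p ->] [q ->]; exists (p - q); rewrite mulrBr. Qed.

Lemma divides0 a : divides a 0.
Proof. by exists 0; rewrite mulr0. Qed.

Lemma divides_sum a (I : Type) (r : seq I) (Q : pred I) (F : I -> R) :
  (forall i, Q i -> divides a (F i)) -> divides a (\sum_(i <- r | Q i) F i).
Proof. by move=> aF; apply: big_ind => //; [exact: divides0 | exact: dividesD]. Qed.

Lemma divides_mul2l c a b : c != 0 -> divides (c * a) (c * b) -> divides a b.
Proof. by move=> c0 [q]; rewrite -mulrA => /(mulfI c0) ->; exists q. Qed.

Lemma primitive_neq0 (I : finType) (v : I -> R) :
  primitive v -> exists i, v i != 0.
Proof.
move=> pv; apply/existsP; apply: contraT; rewrite negb_exists => /forallP v0.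
have [i|q /eqP] := pv 0 1; last by rewrite mul0r oner_eq0.
by move/negPn/eqP: (v0 i) => ->; rewrite mulr0; exact: divides0.
Qed.

(* A domain with greatest common divisors, phrased for finite families. *)
Definition content_domain :=
  forall (I : finType) (v : I -> R), (exists i, v i != 0) ->
  exists d w, primitive w /\ forall i, v i = d * w i.

End Primitive.

(** * Gauss's lemma and common divisors over a polynomial ring *)

Section Gauss.
Variable R : idomainType.

Definition coef_primitive (I : Type) (D : I -> {poly R}) :=
  forall a b : R, (forall i k, divides a (b * (D i)`_k)) -> divides a b.

(** The induction on the size of [q] is what needs the multiplier: the truncation [q'] is handled
    with [b] replaced by [b] times a coefficient of [D i]. *)
Lemma gauss (I : Type) (D : I -> {poly R}) (c b : R) (q : {poly R}) :
  coef_primitive D -> (forall i k, divides c (b * (q * D i)`_k)) ->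
  forall k, divides c (b * q`_k).
Proof.
move=> pD; have [n] := ubnP (size q).
elim: n q b => // n IHn q b; rewrite ltnS => leqn cqD.
have [->|q0] := eqVneq q 0; first by move=> k; rewrite coef0 mulr0; exact: divides0.
have [s szq] : exists s, size q = s.+1.
  by case: size (size_poly_eq0 q) (q0) => [<-|s]; [|exists s].
pose q' := q - q`_s *: 'X^s.
have szq' : (size q' < n)%N.
  apply: leq_trans leqn; rewrite szq ltnS; apply/leq_sizeP => j.
  rewrite leq_eqVlt /q' coefB coefZ coefXn => /predU1P[<-|sj].
    by rewrite eqxx mulr1 subrr.
  by rewrite gtn_eqF // mulr0 subr0 nth_default // szq.
(* The index [k] descends from the top coefficient of [D i]. In degree [s + k] of the product, every
   term except the one isolated here involves a higher coefficient of [D i] or vanishes. *)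
have key i k : forall l, divides c (b * (D i)`_k * q`_l).
  have [m] := ubnP (size (D i) - k); elim: m k => // m IHm k; rewrite ltnS => lem.
  have [szk|kD] := leqP (size (D i)) k.
    by move=> l; rewrite nth_default // mulr0 mul0r; exact: divides0.
  have up j : (k < j)%N -> forall l, divides c (b * (D i)`_j * q`_l).
    by move=> kj; apply: IHm; apply: leq_trans lem; rewrite ltn_sub2l // .
  have lead : divides c (b * (D i)`_k * q`_s).
    have : divides c (b * (q * D i)`_(s + k)) by [].
    rewrite coefM mulr_sumr.
    have lt1 : (s < (s + k).+1)%N by rewrite ltnS leq_addr.
    rewrite (bigD1 (Ordinal lt1)) //= addKn => h.
    have -> : b * (D i)`_k * q`_s = b * (q`_s * (D i)`_k) +
       \sum_(j < (s + k).+1 | j != Ordinal lt1) b * (q`_j * (D i)`_(s + k - j))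
     - \sum_(j < (s + k).+1 | j != Ordinal lt1) b * (q`_j * (D i)`_(s + k - j)).
      by rewrite addrK [q`_s * _]mulrC mulrA.
    apply: dividesB => //; apply: divides_sum => j.
    rewrite -val_eqE /= neq_ltn => /orP[js|sj].
      rewrite [q`_j * _]mulrC mulrA; apply: up.
      by rewrite ltn_subRL ltn_add2r.
    by rewrite nth_default ?szq // mul0r mulr0; exact: divides0.
  have lower : forall l, divides c (b * (D i)`_k * q'`_l).
    apply: IHn => // i' k'.
    have -> : b * (D i)`_k * (q' * D i')`_k' =
        b * (q * D i')`_k' * (D i)`_k
        - b * (D i)`_k * q`_s * ('X^s * D i')`_k'.
      by rewrite /q' mulrBl coefB -scalerAl coefZ; ring.
    by apply: dividesB; apply: dividesMr.
  move=> l; have -> : q`_l = q'`_l + q`_s * (l == s)%:R.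
    by rewrite /q' coefB coefZ coefXn subrK.
  by rewrite mulrDr; apply: dividesD => //; rewrite mulrA; apply: dividesMr.
by move=> k; apply: pD => i l; rewrite mulrAC; exact: key.
Qed.

Lemma divides_coef (c : R) (q : {poly R}) :
  (forall k, divides c q`_k) -> divides c%:P q.
Proof.
move=> cq.
have [f fq] : exists f : 'I_(size q) -> R, forall i : 'I_(size q), q`_i = c * f i.
  apply: (fin_all_exists (P := fun i : 'I_(size q) => fun a => q`_i = c * a)) => i.
  by have [a] := cq i; exists a.
exists (\poly_(i < size q) (if insub i is Some j then f j else 0)).
apply/polyP => i; rewrite coefCM coef_poly; case: ltnP => iq.
  by rewrite insubT /= -fq.
by rewrite mulr0 nth_default.
Qed.

Lemma coef_dvd (c : R) (q : {poly R}) k : divides c%:P q -> divides c q`_k.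
Proof. by case=> p ->; rewrite coefCM; exists p`_k. Qed.

(* D is a nonzero element of least degree in the ideal generated by V. *)
Lemma ideal_generator (I : finType) (V : I -> {poly R}) :
  (exists i, V i != 0) ->
  exists (D : {poly R}) (s : I -> {poly R}), [/\ D != 0, D = \sum_i s i * V i &
    forall i, exists (c : R) q, c != 0 /\ c%:P * V i = q * D].
Proof.
case=> i0 Vi0.
suff gen n (D : {poly R}) (s : I -> {poly R}) : (size D <= n)%N -> D != 0 ->
    D = \sum_i s i * V i ->
    exists (D : {poly R}) (s : I -> {poly R}), [/\ D != 0, D = \sum_i s i * V i &
      forall i, exists (c : R) q, c != 0 /\ c%:P * V i = q * D].
  apply: (gen (size (V i0)) (V i0) (fun i => (i == i0)%:R)) => //.
  rewrite (bigD1 i0) //= eqxx mul1r big1 ?addr0 // => j /negbTE ->.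
  by rewrite mul0r.
elim: n D s => [|n IHn] D s szD D0 Ds.
  by case/negP: D0; rewrite -size_poly_eq0 -leqn0.
have [/forallP mod0|] := boolP [forall i, modp (V i) D == 0].
  exists D, s; split=> // i.
  exists (lead_coef D ^+ scalp (V i) D), (divp (V i) D).
  split; first by rewrite expf_neq0 // lead_coef_eq0.
  by rewrite mul_polyC Pdiv.Idomain.divp_eq (eqP (mod0 i)) addr0.
rewrite negb_forall => /existsP[j modj].
pose c := lead_coef D ^+ scalp (V j) D.
apply: (IHn (modp (V j) D)
  (fun i => (i == j)%:R * c%:P - divp (V j) D * s i)) => //.
  by rewrite -ltnS; apply: leq_trans szD; rewrite ltn_modp.
under eq_bigr do rewrite mulrBl.
rewrite sumrB (bigD1 j) //= eqxx mul1r.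
rewrite [X in _ + X - _]big1 => [|i /negbTE ->]; last by rewrite !mul0r.
rewrite addr0 mul_polyC Pdiv.Idomain.divp_eq.
under eq_bigr do rewrite -mulrA.
by rewrite -mulr_sumr -Ds [X in _ = X]addrC addrA addNr add0r.
Qed.

Hypothesis contR : content_domain R.

Lemma coef_content (I : finType) (V : I -> {poly R}) :
  (exists i, V i != 0) ->
  exists (e : R) (W : I -> {poly R}),
    coef_primitive W /\ forall i, V i = e%:P * W i.
Proof.
move=> [i0 Vi0]; pose N := \max_i size (V i).
have leN i : (size (V i) <= N)%N by exact: leq_bigmax.
have [|e [w [pw Vw]]] := contR (v := fun ij : I * 'I_N => (V ij.1)`_ij.2).
  have lt : ((size (V i0)).-1 < N)%N.
    by apply: leq_trans (leN i0); rewrite ltn_predL size_poly_gt0.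
  by exists (i0, Ordinal lt); rewrite /= -lead_coefE lead_coef_eq0.
pose W i := \poly_(k < N) (if insub k is Some j then w (i, j) else 0).
have Wc i (j : 'I_N) : (W i)`_j = w (i, j).
  by rewrite coef_poly ltn_ord valK.
exists e, W; split.
  by move=> a b ab; apply: pw => -[i j]; rewrite -Wc.
move=> i; apply/polyP => k; rewrite coefCM.
have [kN|Nk] := ltnP k N; first by rewrite -[k]/(val (Ordinal kN)) Wc -Vw.
by rewrite coef_poly ltnNge Nk mulr0 nth_default // (leq_trans (leN i)).
Qed.

(** Over the fraction field [D] is a greatest common divisor, and by Gauss's lemma its primitive
    part [D1] divides every [V i] over [R]. The quotients [w] satisfy a Bezout relation with the
    constant [dlt], so only a constant [e] can still be common to them. *)
Lemma content_domain_poly : content_domain {poly R}.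
Proof.
move=> I V V0; have [D [s [D0 Ds Ddvd]]] := ideal_generator V0.
have [|dlt [D1 [pD1 DD1]]] := coef_content (V := fun _ : unit => D).
  by exists tt.
move: D1 pD1 DD1 => D1f pD1; set D1 := D1f tt => /(_ tt); rewrite -/D1 => DD1.
have gauss1 (c b : R) q : (forall k, divides c (b * (q * D1)`_k)) ->
    forall k, divides c (b * q`_k).
  by move=> h; apply: (gauss pD1) => -[].
have dlt0 : dlt != 0 by apply: contraNneq D0 => d0; rewrite DD1 d0 mul0r.
have D10 : D1 != 0 by apply: contraNneq D0 => d0; rewrite DD1 d0 mulr0.
have divC (c : R) (A q : {poly R}) : c != 0 -> c%:P * A = q * D1 ->
    exists w, A = w * D1.
  move=> c0 cA; have [|w qw] := @divides_coef c q.
    move=> k; rewrite -[q`_k]mul1r; apply: gauss1 => l.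
    by rewrite mul1r -cA coefCM; exists A`_l.
  exists w; apply: (mulfI (x := c%:P)); first by rewrite polyC_eq0.
  by rewrite cA qw mulrA.
have [w Vw] : exists w : I -> {poly R}, forall i, V i = w i * D1.
  apply: (fin_all_exists (P := fun i (a : {poly R}) => V i = a * D1)) => i.
  have [c [q [c0 cV]]] := Ddvd i.
  by apply: (divC c _ (q * dlt%:P) c0); rewrite cV DD1 mulrA.
have bez : dlt%:P = \sum_i s i * w i.
  apply: (mulIf D10); rewrite -DD1 Ds mulr_suml.
  by apply: eq_bigr => i _; rewrite Vw mulrA.
have [|e [w' [pw' ww']]] := coef_content (V := w).
  have [i Vi] := V0; exists i; apply: contraNneq Vi => wi.
  by rewrite Vw wi mul0r.
exists (e%:P * D1), w'; split; last by move=> i; rewrite Vw ww' mulrAC.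
move=> A B AB.
have [A0|A0] := eqVneq A 0.
  have {}AB i : B * w' i = 0 by have [q ->] := AB i; rewrite A0 mul0r.
  have : B * dlt%:P = 0.
    rewrite bez mulr_sumr big1 // => i _.
    have -> : B * (s i * w i) = s i * e%:P * (B * w' i) by rewrite ww'; ring.
    by rewrite AB mulr0.
  move/eqP; rewrite mulf_eq0 polyC_eq0 (negbTE dlt0) orbF => /eqP ->.
  exact: divides0.
(* With [A = a A1], the Bezout relation and Gauss's lemma for [A1] give [A1 | B]; the constant [a]
   is then handled by Gauss's lemma for [w']. *)
have [|a [A1f [pA1 AA1]]] := coef_content (V := fun _ : unit => A).
  by exists tt.
move: A1f pA1 AA1 => A1f pA1; set A1 := A1f tt => /(_ tt); rewrite -/A1 => AA1.
have A10 : A1 != 0 by apply: contraNneq A0 => d0; rewrite AA1 d0 mulr0.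
have [C BA] : divides A1 B.
  have [C BC] : divides A (B * dlt%:P).
    rewrite bez mulr_sumr; apply: divides_sum => i _.
    have -> : B * (s i * w i) = s i * e%:P * (B * w' i) by rewrite ww'; ring.
    exact: dividesMl.
  have [|C' CC'] := @divides_coef dlt (a%:P * C).
    move=> k; rewrite -[_`_k]mul1r; apply: (gauss pA1) => -[] l.
    rewrite -/A1 mul1r mulrAC -AA1 -BC mulrC coefCM; by exists B`_l.
  exists C'; apply: (mulfI (x := dlt%:P)); first by rewrite polyC_eq0.
  by rewrite mulrC BC AA1 mulrAC CC'; ring.
have [|C' CC'] := @divides_coef a C.
  move=> k; rewrite -[C`_k]mul1r; apply: (gauss pw') => i l; rewrite mul1r.
  apply: coef_dvd; apply: (divides_mul2l A10).
  by rewrite mulrA -BA mulrC -AA1.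
by exists C'; rewrite BA AA1 CC'; ring.
Qed.

End Gauss.

(** * Common divisors in several variables *)

Section ContentMPoly.
Variable K : fieldType.

Lemma content_domain_iso (R S : idomainType) (f : {rmorphism S -> R})
    (g : {rmorphism R -> S}) :
  cancel f g -> cancel g f -> content_domain R -> content_domain S.
Proof.
move=> fK gK contR I v [i0 vi0].
have [|d [w [pw vw]]] := contR I (f \o v).
  by exists i0; rewrite /= -(can_eq gK) fK rmorph0.
exists (g d), (g \o w); split=> [a b ab|i]; last first.
  by rewrite /= -rmorphM -vw /= fK.
have [|q bq] := pw (f a) (f b).
  move=> i; have [q bq] := ab i; exists (f q).
  by rewrite -rmorphM -bq rmorphM /= gK.
by exists (g q); rewrite -[a]fK -rmorphM -bq fK.
Qed.

Lemma mpoly_rmorph_ext n (S : comNzRingType)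
    (f g : {rmorphism {mpoly K[n]} -> S}) :
  (forall c, f c%:MP = g c%:MP) -> (forall i, f 'X_i = g 'X_i) -> f =1 g.
Proof.
move=> fgC fgX p; rewrite (mpolyE p) !rmorph_sum; apply: eq_bigr => m _.
rewrite -mul_mpolyC mpolyXE_id !rmorphM fgC !rmorph_prod; congr (_ * _).
by apply: eq_bigr => i _; rewrite !rmorphXn fgX.
Qed.

Lemma muni_widen n (i : 'I_n) :
  muni ('X_(widen_ord (leqnSn n) i) : {mpoly K[n.+1]}) = ('X_i)%:P.
Proof.
rewrite muniE msuppX big_seq1 mcoeffX eqxx scale1r mnm1E.
rewrite -val_eqE /= ltn_eqF // expr0 alg_polyC; congr ('X_[_])%:P.
by apply/mnmP => j; rewrite mnmE !mnm1E.
Qed.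

Lemma muni_ord_max n : muni ('X_ord_max : {mpoly K[n.+1]}) = 'X.
Proof.
rewrite muniE msuppX big_seq1 mcoeffX eqxx scale1r mnm1E eqxx expr1.
rewrite (_ : [multinom _ | _ < _] = 0%MM) ?mpolyX0 ?scale1r //.
by apply/mnmP => j; rewrite mnmE mnm1E mnm0E -val_eqE /= gtn_eqF.
Qed.

Lemma muni_mwiden n (c : {mpoly K[n]}) : muni (mwiden c) = c%:P.
Proof.
apply: (@mpoly_rmorph_ext _ _
  (@muni n K \o @mwiden n K) (@polyC {mpoly K[n]})) => [a|i] /=.
  by rewrite mwidenC muniC.
by rewrite mwidenX mnmwiden1 muni_widen.
Qed.

(** Induction on [n], with [muni] as the isomorphism onto polynomials in the last variable. Without
    variables the ring is a field, where every nonzero family is primitive. *)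
Lemma content_domain_mpoly n : content_domain {mpoly K[n]}.
Proof.
elim: n => [|n IHn].
  move=> I v [i vi]; exists 1, v; split=> [a b ab|j]; last by rewrite mul1r.
  have [q bq] := ab i; exists (q * ((v i)@_0)^-1%:MP).
  rewrite mulrA -bq -mulrA -{1}(mpolyKC (v i)) -mpolyCM divff ?mulr1 //.
  by apply: contraNneq vi => v0; rewrite -(mpolyKC (v i)) v0.
pose f : {rmorphism {mpoly K[n.+1]} -> {poly {mpoly K[n]}}} := @muni n K.
pose g : {rmorphism {poly {mpoly K[n]}} -> {mpoly K[n.+1]}} :=
  horner_eval ('X_ord_max) \o map_poly (@mwiden n K).
apply: (@content_domain_iso {poly {mpoly K[n]}} {mpoly K[n.+1]} f g).
- apply: (@mpoly_rmorph_ext _ _ (g \o @muni n K) idfun) => [a|i] /=.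
    by rewrite muniC map_polyC /horner_eval hornerC; exact: mwidenC.
  rewrite /horner_eval; case: (unliftP ord_max i) => [j|] ->.
    have -> : lift ord_max j = widen_ord (leqnSn n) j.
      by apply: val_inj; rewrite /= /bump leqNgt ltn_ord.
    rewrite muni_widen map_polyC hornerC.
    by transitivity (mwiden ('X_j : {mpoly K[n]})); rewrite // mwidenX mnmwiden1.
  by rewrite muni_ord_max map_polyX hornerX.
- move=> p; rewrite /g /= /horner_eval.
  elim/poly_ind: p => [|p c IHp]; first by rewrite rmorph0 horner0 rmorph0.
  rewrite rmorphD rmorphM /= map_polyX map_polyC hornerD hornerMX hornerC.
  by rewrite rmorphD rmorphM /= IHp muni_mwiden muni_ord_max.
- exact: content_domain_poly.
Qed.

End ContentMPoly.

(** * Homogeneous polynomials and Euler's formula *)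

Section Homogeneous.
Variables (K : fieldType) (n : nat).
Implicit Types (p q : {mpoly K[n]}).

Lemma mlastcM p q : p != 0 -> q != 0 ->
  (p * q)@_(mlast p + mlast q) = p@_(mlast p) * q@_(mlast q).
Proof.
move=> p0 q0.
rewrite mpolyME (bigD1_seq (mlast p, mlast q)) /=; first last.
+ by rewrite allpairs_uniq // => -[? ?] [].
+ by rewrite allpairs_f// !mlast_supp.
rewrite mcoeffD mcoeffZ mcoeffX eqxx mulr1.
rewrite big_seq_cond raddf_sum /= big1 ?addr0 //.
move=> m /andP[/allpairsP[[m1 m2] [/= /mlast_lemc le1 /mlast_lemc le2 ->]] ne].
rewrite mcoeffZ mcoeffX /=.
case: eqP => [e|_]; last by rewrite mulr0.
move: le1; rewrite le_eqVlt => /predU1P[e1|lt1].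
  case/eqP: ne; rewrite -e1; congr (_, _); apply/esym.
  by move: e; rewrite -e1 => /addmI ->.
by have := ltmc_le_add lt1 le2; rewrite e ltxx.
Qed.

(** Highest degrees add up under multiplication, and so do lowest degrees. If the two agree for the
    product, they agree for each factor. *)
Lemma dhomog_factor d p q : p * q != 0 -> p * q \is d.-homog ->
  exists e, [/\ (e <= d)%N, p \is e.-homog & q \is (d - e).-homog].
Proof.
move=> pq0 /dhomogP hpq.
have [p0 q0] : p != 0 /\ q != 0 by by move: pq0; rewrite mulf_eq0 => /norP.
have top : (mdeg (mlead p) + mdeg (mlead q) = d)%N.
  rewrite -mdegD -mleadM //; exact/hpq/mlead_supp.
have bot : (mdeg (mlast p) + mdeg (mlast q) = d)%N.
  rewrite -mdegD; apply: hpq; rewrite mcoeff_msupp mlastcM //.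
  by rewrite mulf_neq0 // -mcoeff_msupp mlast_supp.
have bd (r : {mpoly K[n]}) : r != 0 -> forall m, m \in msupp r ->
    (mdeg (mlast r) <= mdeg m <= mdeg (mlead r))%N.
  move=> r0 m mr; rewrite !lemc_mdeg //; last exact: mlast_lemc.
  exact: msupp_le_mlead.
have /andP[_ lp] := bd p p0 _ (mlast_supp p0).
have /andP[_ lq] := bd q q0 _ (mlast_supp q0).
move: (mdeg (mlead p)) (mdeg (mlead q)) (mdeg (mlast p)) (mdeg (mlast q))
  top bot lp lq (bd p p0) (bd q q0) => a b a' b' top bot lp lq bdp bdq.
have [ea eb eb' ad] : [/\ a' = a, b' = (d - a)%N, b = (d - a)%N & (a <= d)%N].
  by split; lia.
exists a; split=> //; apply/dhomogP => m.
  by move/bdp; rewrite ea -eqn_leq => /eqP.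
by move/bdq; rewrite eb eb' -eqn_leq => /eqP.
Qed.

Lemma dhomog0E p : p \is 0.-homog -> p = (p@_0)%:MP.
Proof.
move=> /dhomogP h; apply/mpolyP => m; rewrite mcoeffC.
have [->|m0] := eqVneq m 0%MM; first by rewrite mulr1.
rewrite mulr0; apply: memN_msupp_eq0; apply: contraNN m0.
by move/h => /eqP; rewrite mdeg_eq0.
Qed.

Lemma mderiv_homog0 p i : p \is 0.-homog -> p^`M(i) = 0.
Proof. by move/dhomog0E ->; rewrite mderivC. Qed.

Lemma mderiv_homogS d p i : p \is d.+1.-homog -> p^`M(i) \is d.-homog.
Proof.
move=> /dhomogP h; apply/dhomogP => m; rewrite mcoeff_msupp mcoeff_deriv.
move=> nz; have : (m + U_(i))%MM \in msupp p.
  by rewrite mcoeff_msupp; apply: contraNneq nz => ->; rewrite mul0rn.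
have md : mdeg (m + U_(i))%MM = (mdeg m).+1 by rewrite mdegD mdeg1 addn1.
by move/h => e; move: md; rewrite [LHS]e => -[->].
Qed.

Lemma mderiv_homog d p i : p \is d.-homog -> p^`M(i) \is d.-1.-homog.
Proof.
by case: d => [/mderiv_homog0 ->|d /mderiv_homogS]; [exact: dhomog0|].
Qed.

Lemma euler d p : p \is d.-homog -> \sum_i 'X_i * p^`M(i) = d%:R *: p.
Proof.
move=> /dhomogP h.
have ed i : 'X_i * p^`M(i) = \sum_(m <- msupp p) (m i)%:R *: (p@_m *: 'X_[m]).
  rewrite mulr_sumr; apply: eq_bigr => m _.
  have [->|mi] := posnP (m i); first by rewrite mul0r !scale0r mulr0.
  rewrite -scalerAr -mpolyXD scalerA addmC submK // lep1mP -lt0n //.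
under eq_bigr do rewrite ed.
rewrite exchange_big /= [in RHS](mpolyE p) scaler_sumr.
rewrite !big_seq; apply: eq_bigr => m /h <-.
by rewrite -scaler_suml -natr_sum; congr (_%:R *: _); exact/esym/mdegE.
Qed.

End Homogeneous.

(** * Vectors of length three *)

Definition o0 : 'I_3 := Ordinal (isT : 0 < 3)%N.
Definition o1 : 'I_3 := Ordinal (isT : 1 < 3)%N.
Definition o2 : 'I_3 := Ordinal (isT : 2 < 3)%N.

Lemma ord3P (Q : 'I_3 -> Prop) : Q o0 -> Q o1 -> Q o2 -> forall i, Q i.
Proof.
move=> q0 q1 q2 [[|[|[|i]]] lti] //.
- by rewrite (_ : Ordinal lti = o0) //; apply: val_inj.
- by rewrite (_ : Ordinal lti = o1) //; apply: val_inj.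
- by rewrite (_ : Ordinal lti = o2) //; apply: val_inj.
Qed.

Lemma sum3 (V : nmodType) (F : 'I_3 -> V) :
  \sum_i F i = F o0 + F o1 + F o2.
Proof.
rewrite !big_ord_recl big_ord0 addr0 addrA.
by congr (F _ + F _ + F _); apply: val_inj.
Qed.

Section Vectors.
Variable R : comNzRingType.
Implicit Types (a b c : 'I_3 -> R) (k : 'I_3).

Definition dot a b := a o0 * b o0 + a o1 * b o1 + a o2 * b o2.

Definition cross a b k :=
  match val k with
  | 0 => a o1 * b o2 - a o2 * b o1
  | 1 => a o2 * b o0 - a o0 * b o2
  | _ => a o0 * b o1 - a o1 * b o0
  end.

Definition parallel a b := forall i j, a i * b j = a j * b i.

Lemma crossP a b : (forall k, cross a b k = 0) <-> parallel a b.
Proof.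
split=> [ab|ab k].
  have := (ab o0, ab o1, ab o2); rewrite /cross /= => -[[e0 e1] e2].
  move/subr0_eq: e0 => e0; move/subr0_eq: e1 => e1; move/subr0_eq: e2 => e2.
  by elim/ord3P; elim/ord3P.
by elim/ord3P: k; rewrite /cross /=; apply/eqP; rewrite subr_eq0; apply/eqP.
Qed.

Lemma parallelC a b : parallel a b -> parallel b a.
Proof. by move=> ab i j; rewrite mulrC -ab mulrC. Qed.

Lemma dotC a b : dot a b = dot b a.
Proof. by rewrite /dot; ring. Qed.

Lemma crossvv a k : cross a a k = 0.
Proof. by elim/ord3P: k; rewrite /cross /=; ring. Qed.

Lemma cross_crossl a b c k :
  cross (cross a b) c k = b k * dot a c - a k * dot b c.
Proof. by elim/ord3P: k; rewrite /cross /dot /=; ring. Qed.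

Lemma cross_crossr a b c k :
  cross a (cross b c) k = b k * dot a c - c k * dot a b.
Proof. by elim/ord3P: k; rewrite /cross /dot /=; ring. Qed.

Lemma dot_crossl a b : dot (cross a b) a = 0.
Proof. by rewrite /cross /dot /=; ring. Qed.

Lemma dot_crossr a b : dot (cross a b) b = 0.
Proof. by rewrite /cross /dot /=; ring. Qed.

Lemma eq_dot a b c : a =1 b -> dot a c = dot b c.
Proof. by move=> ab; rewrite /dot !ab. Qed.

Lemma eq_dotr a b c : a =1 b -> dot c a = dot c b.
Proof. by move=> ab; rewrite /dot !ab. Qed.

Lemma dot_eq0 a b : (forall i, b i = 0) -> dot a b = 0.
Proof. by move=> b0; rewrite /dot !b0 !mulr0 !addr0. Qed.

Lemma dotZr r a b : dot a (fun i => r * b i) = r * dot a b.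
Proof. by rewrite /dot; ring. Qed.

Lemma dot_exchange (M : 'I_3 -> 'I_3 -> R) a b :
  dot a (fun i => dot (M i) b) = dot (fun l => dot a (fun i => M i l)) b.
Proof. by rewrite /dot; ring. Qed.

Lemma eq_cross a b c : a =1 b -> cross c a =1 cross c b.
Proof. by move=> ab k; rewrite /cross !ab. Qed.

Lemma eq_crossl a b c : a =1 b -> cross a c =1 cross b c.
Proof. by move=> ab k; rewrite /cross !ab. Qed.

Lemma dotZ r a b : dot (fun i => r * a i) b = r * dot a b.
Proof. by rewrite /dot; ring. Qed.

Lemma crossZ r a b k : cross a (fun i => r * b i) k = r * cross a b k.
Proof. by elim/ord3P: k; rewrite /cross /=; ring. Qed.

Lemma crossZl r a b k : cross (fun i => r * a i) b k = r * cross a b k.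
Proof. by elim/ord3P: k; rewrite /cross /=; ring. Qed.

(** The rows of the cofactor matrix, which is the transpose of the adjugate; hence the swapped
    indices when it is compared with the square of [M]. *)
Definition cofactor3 (M : 'I_3 -> 'I_3 -> R) k :=
  match val k with
  | 0 => cross (M o1) (M o2)
  | 1 => cross (M o2) (M o0)
  | _ => cross (M o0) (M o1)
  end.

Definition det3 (M : 'I_3 -> 'I_3 -> R) := dot (M o0) (cofactor3 M o0).

Section Singular.
Variable M : 'I_3 -> 'I_3 -> R.
Hypothesis detM : det3 M = 0.

Lemma row_cofactor3 i k : dot (M i) (cofactor3 M k) = 0.
Proof.
have [->|/negbTE ik] := eqVneq i k.
  by rewrite -detM; elim/ord3P: k; rewrite /det3 /cofactor3 /cross /dot /=; ring.
by elim/ord3P: k ik; elim/ord3P: i => // _; rewrite /cofactor3 /cross /dot /=; ring.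
Qed.

Lemma col_cofactor3 i k :
  dot (fun l => cofactor3 M l i) (fun l => M l k) = 0.
Proof.
have [->|/negbTE ik] := eqVneq i k.
  by rewrite -detM; elim/ord3P: k; rewrite /det3 /cofactor3 /cross /dot /=; ring.
by elim/ord3P: k ik; elim/ord3P: i => // _; rewrite /cofactor3 /cross /dot /=; ring.
Qed.

(** The adjugate of a singular matrix has rank at most one: [cofactor3 M i] is a cross product of
    two rows of [M], both orthogonal to [cofactor3 M k]. *)
Lemma cofactor3_parallel i k : parallel (cofactor3 M i) (cofactor3 M k).
Proof.
apply/crossP => l; rewrite [cofactor3 M i]/cofactor3.
by elim/ord3P: i => /=; rewrite cross_crossl !row_cofactor3 !mulr0 subrr.
Qed.

End Singular.

(* Cayley-Hamilton for the characteristic polynomial X^3. *)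
Lemma cofactor3_square (M : 'I_3 -> 'I_3 -> R) k l :
  M o0 o0 + M o1 o1 + M o2 o2 = 0 ->
  cofactor3 M o0 o0 + cofactor3 M o1 o1 + cofactor3 M o2 o2 = 0 ->
  cofactor3 M k l = dot (M l) (fun m => M m k).
Proof.
set t := (X in X = 0 -> _); set s := (X in _ -> X = 0 -> _) => t0 s0.
have -> : cofactor3 M k l =
    dot (M l) (fun m => M m k) - t * M l k + s * (k == l)%:R.
  by elim/ord3P: k; elim/ord3P: l; rewrite /t /s /cofactor3 /cross /dot /=; ring.
by rewrite t0 s0 !mul0r subr0 addr0.
Qed.

Lemma cross_columns (M : 'I_3 -> 'I_3 -> R) k :
  [/\ cross (fun l => M l o1) (fun l => M l o2) k = cofactor3 M k o0,
      cross (fun l => M l o2) (fun l => M l o0) k = cofactor3 M k o1 &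
      cross (fun l => M l o0) (fun l => M l o1) k = cofactor3 M k o2].
Proof. by elim/ord3P: k; rewrite /cofactor3 /cross /=; split; ring. Qed.

End Vectors.

Section VectorsIdomain.
Variable R : idomainType.
Implicit Types (a b v w z : 'I_3 -> R).

Lemma parallel_both a b z k : parallel a z -> parallel b z ->
  cross a b k != 0 -> forall i, z i = 0.
Proof.
move=> az bz abk i; apply: (mulIf abk); rewrite mul0r.
have [az' bz'] := (az, bz).
have e l m : a l * b m * z i = a m * b l * z i.
  by rewrite -mulrA bz mulrCA az mulrCA bz mulrA.
by elim/ord3P: k {abk}; rewrite /cross /= mulrBr mulrC e mulrC subrr.
Qed.

Lemma primitive_parallel w v : primitive w -> parallel w v ->
  exists th, forall i, v i = th * w i.
Proof.
move=> pw wv; have [i wi] := primitive_neq0 pw.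
have [|th vth] := pw (w i) (v i).
  by move=> j; exists (v j); rewrite wv mulrC.
exists th => j; apply: (mulfI wi); rewrite wv vth; ring.
Qed.

End VectorsIdomain.

(** * Vectors of homogeneous polynomials *)

Section HomogeneousVectors.
Variable K : fieldType.
Local Notation P := {mpoly K[3]}.
Implicit Types (f g : P) (u v w : 'I_3 -> P).

Definition homog_vec d v := forall i, v i \is d.-homog.
Definition grad f : 'I_3 -> P := fun l => f^`M(l).
Definition pderiv l v : 'I_3 -> P := fun i => (v i)^`M(l).
Definition xvec : 'I_3 -> P := fun i => 'X_i.
Definition dependent v :=
  exists c : 'I_3 -> K, (exists i, c i != 0) /\ \sum_i c i *: v i = 0.

Lemma dhomogB d f g : f \is d.-homog -> g \is d.-homog -> f - g \is d.-homog.
Proof. by move=> hf hg; rewrite rpredB. Qed.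

Lemma dot_homog d e u v :
  homog_vec d u -> homog_vec e v -> dot u v \is (d + e).-homog.
Proof. by move=> hu hv; rewrite /dot !rpredD // dhomogM. Qed.

Lemma cross_homog d e u v :
  homog_vec d u -> homog_vec e v -> homog_vec (d + e) (cross u v).
Proof.
by move=> hu hv; elim/ord3P; rewrite /cross /=; apply: dhomogB; apply: dhomogM.
Qed.

Lemma xvec_homog : homog_vec 1 xvec.
Proof. by move=> i; rewrite dhomogX; apply/eqP; exact: mdeg1. Qed.

Lemma natr_homog m : (m%:R : P) \is 0.-homog.
Proof. by rewrite -scaler_nat; apply: dhomogZ; apply: dhomog1. Qed.

Lemma mpolyC_homog (a : K) : a%:MP_[3] \is 0.-homog.
Proof. by rewrite -[a%:MP_[3]]mulr1 mul_mpolyC; apply: dhomogZ; apply: dhomog1. Qed.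

Lemma scale_homog m d f : f \is d.-homog -> m%:R * f \is d.-homog.
Proof. by move=> hf; rewrite -[d]add0n dhomogM // natr_homog. Qed.

Lemma pderiv_homog d l v : homog_vec d v -> homog_vec d.-1 (pderiv l v).
Proof. by move=> hv i; exact: mderiv_homog. Qed.

Lemma euler_dot d f : f \is d.-homog -> dot xvec (grad f) = d%:R * f.
Proof. by move=> /euler; rewrite sum3 scaler_nat => e; rewrite mulr_natl -e. Qed.

Lemma mderiv_dot l u v :
  (dot u v)^`M(l) = dot (pderiv l u) v + dot u (pderiv l v).
Proof. by rewrite /dot /pderiv !mderivD !mderivM; ring. Qed.

Lemma pderiv_xvec l i : pderiv l xvec i = (i == l)%:R.
Proof.
rewrite /pderiv /xvec mderivX mnm1E; have [->|_] := eqVneq; last first.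
  by rewrite scale0r.
rewrite scale1r (_ : (_ - _)%MM = 0%MM) ?mpolyX0 //.
by apply/mnmP => j; rewrite mnmE subnn mnm0E.
Qed.

Lemma dot_pderiv_xvec l u : dot u (pderiv l xvec) = u l.
Proof. by elim/ord3P: l; rewrite /dot !pderiv_xvec /=; ring. Qed.

Lemma primitive_part d v : homog_vec d v -> (exists i, v i != 0) ->
  exists h e w, [/\ (e <= d)%N, h != 0 & h \is (d - e).-homog] /\
    [/\ primitive w, homog_vec e w & forall i, v i = h * w i].
Proof.
move=> hv v0; have [h [w [pw vw]]] := content_domain_mpoly v0.
have [i vi] := v0; have hw0 : h * w i != 0 by rewrite -vw.
have [|e [led hh hw]] := @dhomog_factor _ _ d _ _ hw0; first by rewrite -vw.
have h0 : h != 0 by apply: contraNneq hw0 => ->; rewrite mul0r.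
exists h, (d - e)%N, w; split; first by split; rewrite ?leq_subr ?subKn.
split=> // j; have [->|wj] := eqVneq (w j) 0; first exact: dhomog0.
have [||e' [_ hh' hw']] := @dhomog_factor _ _ d h (w j).
- by rewrite mulf_neq0.
- by rewrite -vw.
by rewrite (dhomog_uniq h0 hh hh').
Qed.

Lemma primitive_parallel_le w v d e : primitive w -> homog_vec d w ->
  homog_vec e v -> parallel w v -> (exists i, v i != 0) -> (d <= e)%N.
Proof.
move=> pw hw hv /(primitive_parallel pw) [th vth] [i vi].
have [||s [les _]] := @dhomog_factor _ _ e th (w i); rewrite -?vth //.
have wi : w i != 0 by apply: contraNneq vi => wi; rewrite vth wi mulr0.
by move/(dhomog_uniq wi (hw i)) => ->; exact: leq_subr.
Qed.

(** A nonzero vector parallel to [w] is a multiple of [w], but the derivative has smaller degree.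
    The conclusion is vanishing of the derivative, not constancy, so it is valid in every
    characteristic. *)
Lemma primitive_pderiv w d l : primitive w -> homog_vec d w ->
  parallel w (pderiv l w) -> forall i, pderiv l w i = 0.
Proof.
move=> pw hw par i; case: d hw => [|d] hw.
  by rewrite /pderiv mderiv_homog0.
apply/eqP; apply: contraT => nz.
have := primitive_parallel_le pw hw (pderiv_homog l hw) par (ex_intro _ i nz).
by rewrite ltnn.
Qed.

Lemma mulr_natP (m : nat) f : m%:R != 0 :> K -> m%:R * f = 0 -> f = 0.
Proof.
move=> m0 /eqP; rewrite mulr_natl -scaler_nat -mul_mpolyC mulf_eq0 mpolyC_eq0.
by rewrite (negbTE m0) => /eqP.
Qed.

Lemma natP_neq0 (m : nat) : m%:R != 0 :> K -> m%:R != 0 :> P.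
Proof.
move=> m0; apply/eqP => e; have := mulr_natP m0 (f := 1).
by rewrite e mul0r => /(_ erefl) /eqP; rewrite oner_eq0.
Qed.

Lemma dependent_const (gam : 'I_3 -> K) v : (exists i, gam i != 0) ->
  parallel v (fun i => (gam i)%:MP) -> dependent v.
Proof.
move=> [i gi] par; pose j := i + 1.
have ij : i != j by rewrite /j; elim/ord3P: (i).
have ji : (j == i) = false by rewrite eq_sym (negbTE ij).
exists (fun k => (k == j)%:R * gam i - (k == i)%:R * gam j); split.
  by exists j; rewrite eqxx ji mul1r mul0r subr0.
rewrite (bigD1 i) // (bigD1 j) ?ji //= big1 ?addr0; last first.
  by move=> k /andP[/negbTE -> /negbTE ->]; rewrite !mul0r subrr scale0r.
rewrite !eqxx (negbTE ij) !mul0r !mul1r sub0r subr0.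
by rewrite -!mul_mpolyC mulrC mpolyCN mulrN par [_ * v j]mulrC addNr.
Qed.

Section SmallDegree.
Hypothesis char2 : 2%:R != 0 :> K.
Hypothesis char3 : 3%:R != 0 :> K.

Lemma char_small m : (0 < m <= 4)%N -> m%:R != 0 :> K.
Proof.
move: m => [|[|[|[|[|m]]]]] // _; first exact: oner_neq0.
by rewrite -[4%N]/(2 * 2)%N natrM mulf_neq0.
Qed.

(* A relation whose coefficients are killed by all derivations is differentiated
   d times, which turns each monomial of v into a nonzero constant. *)
Lemma dependent_coef d (lam v : 'I_3 -> P) : (d <= 4)%N -> homog_vec d v ->
  (forall l i, pderiv l lam i = 0) -> dot lam v = 0 ->
  forall m, \sum_i (lam i)@_m *: v i = 0.
Proof.
elim: d v => [|d IHd] v led hv lam0 lamv m.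
  have vC i : v i = ((v i)@_0)%:MP by exact: dhomog0E.
  have := congr1 (mcoeff m) lamv; rewrite /dot !mcoeffD mcoeff0 => e.
  rewrite sum3 -[RHS](mpolyC0 3 K) -e !mpolyCD.
  by congr (_ + _ + _); rewrite [in LHS]vC [in RHS]vC mulrC mcoeffCM;
    rewrite -mul_mpolyC -mpolyCM mulrC.
set s := \sum_i _.
have hs : s \is d.+1.-homog by apply: rpred_sum => i _; apply: rpredZ.
have ds l : s^`M(l) = 0.
  rewrite /s raddf_sum /=; under eq_bigr do rewrite mderivZ.
  apply: (IHd (pderiv l v)) => //; [exact: ltnW | exact: (pderiv_homog l hv) |].
  have := mderiv_dot l lam v; rewrite lamv mderiv0 => e.
  by rewrite [RHS]e /dot !lam0; ring.
apply: (@mulr_natP d.+1); first exact: char_small.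
by rewrite -euler_dot // /dot /grad !ds; ring.
Qed.

(** In characteristic p the entries of [lam] may be nonconstant polynomials in p-th powers. The
    coefficients at the leading monomial of a nonzero entry supply the constant relation. *)
Lemma dependent_pderiv0 (lam v : 'I_3 -> P) : homog_vec 4 v ->
  (exists i, lam i != 0) ->
  (forall l i, pderiv l lam i = 0) -> dot lam v = 0 -> dependent v.
Proof.
move=> hv [i lami] lam0 lamv.
exists (fun j => (lam j)@_(mlead (lam i))); split.
  by exists i; rewrite mleadc_eq0.
exact: (dependent_coef (d := 4)).
Qed.

(** The derivatives of the primitive part vanish, and its degree is at most 4, so Euler's formula
    leaves only degree 0. *)
Lemma parallel_derivs_const d v : (d <= 4)%N -> homog_vec d v ->
  (exists i, v i != 0) -> (forall l, parallel v (pderiv l v)) ->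
  exists h (gam : 'I_3 -> K), (exists i, gam i != 0) /\ forall i, v i = h * (gam i)%:MP.
Proof.
move=> led hv v0 par.
have [h [e [w [[lee h0 hh] [pw hw vw]]]]] := primitive_part hv v0.
have w0 l i : pderiv l w i = 0.
  apply: (primitive_pderiv pw hw) => {}i j.
  apply: (mulfI (mulf_neq0 h0 h0)); have := par l i j.
  rewrite /pderiv !vw !mderivM => par'.
  have -> : h * h * (w i * (w j)^`M(l)) =
     h * w i * (h^`M(l) * w j + h * (w j)^`M(l)) - h * h^`M(l) * w i * w j by ring.
  by rewrite par'; ring.
have e0 : e = 0%N.
  apply/eqP; rewrite -leqn0 leqNgt; apply/negP => egt.
  have [i wi] := primitive_neq0 pw; case/eqP: wi.
  apply: (@mulr_natP e); first by apply: char_small; rewrite egt; lia.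
  rewrite -euler_dot // /dot /grad.
  by have w0' l : (w i)^`M(l) = 0 := w0 l i; rewrite !w0'; ring.
have wC i : w i = ((w i)@_0)%:MP by apply: dhomog0E; have := hw i; rewrite e0.
exists h, (fun i => (w i)@_0); split; last by move=> i; rewrite vw -wC.
have [i wi] := primitive_neq0 pw; exists i.
by apply: contraNneq wi => wi; rewrite wC wi.
Qed.

End SmallDegree.

End HomogeneousVectors.

(** * Linear dependence of the components *)

Section Dependence.
Variable K : fieldType.
Hypothesis char2 : 2%:R != 0 :> K.
Hypothesis char3 : 3%:R != 0 :> K.
Local Notation P := {mpoly K[3]}.

(** All columns are parallel to one nonzero column, hence polynomial multiples of its primitive part
    [lam]. *)
Lemma rank_one_factor d (C : 'I_3 -> 'I_3 -> P) :
  (forall k, homog_vec d (C k)) -> (forall i k, parallel (C i) (C k)) ->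
  (exists k l, C k l != 0) ->
  exists dl du lam u, [/\ (dl + du = d)%N, primitive lam, homog_vec dl lam,
    homog_vec du u & forall k l, C k l = u l * lam k].
Proof.
move=> hC par [k0 [l0 C0]].
have [|g [dl [lam [[led g0 hg] [pl hl Cl]]]]] :=
  @primitive_part _ d (fun k => C k l0) (fun k => hC k l0).
  by exists k0.
have [u Cu] : exists u : 'I_3 -> P, forall l, forall k, C k l = u l * lam k.
  apply: (fin_all_exists (P := fun l (a : P) => forall k, C k l = a * lam k)) => l.
  apply: primitive_parallel => // i j; apply: (mulfI g0).
  by rewrite !mulrA -!Cl par mulrC.
have [k1 lk1] := primitive_neq0 pl.
exists dl, (d - dl)%N, lam, u; split=> //; first exact: subnKC.
move=> l; have [->|ul] := eqVneq (u l) 0; first exact: dhomog0.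
have [||e [_ hu hl']] := @dhomog_factor _ _ d (u l) (lam k1).
- by rewrite mulf_neq0.
- by rewrite -Cu; apply: hC.
have [||e' [led' hl1 hu']] := @dhomog_factor _ _ d (lam k1) (u l).
- by rewrite mulf_neq0.
- by rewrite mulrC -Cu; apply: hC.
by rewrite (dhomog_uniq lk1 (hl k1) hl1).
Qed.

(** * Rank two: the factored adjugate *)

Section Factored.
Variables (H : 'I_3 -> P).
Hypothesis homH : homog_vec 4 H.
Let J i := grad (H i).
Hypothesis trJ : J o0 o0 + J o1 o1 + J o2 o2 = 0.
Hypothesis minJ : cofactor3 J o0 o0 + cofactor3 J o1 o1 + cofactor3 J o2 o2 = 0.
Hypothesis detJ : det3 J = 0.
Hypothesis H0 : exists i, H i != 0.

Variables (dl du : nat) (lam u : 'I_3 -> P).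
Hypothesis plam : primitive lam.
Hypothesis hlam : homog_vec dl lam.
Hypothesis hu : homog_vec du u.
Hypothesis cofE : forall k l, cofactor3 J k l = u l * lam k.
Hypothesis u0 : exists i, u i != 0.

Let lam0 : exists i, lam i != 0 := primitive_neq0 plam.

Lemma four_neq0 : 4%:R != 0 :> P.
Proof. by apply: natP_neq0; exact: char_small. Qed.

Lemma J_u i : dot (J i) u = 0.
Proof.
have [k lk] := lam0; apply: (mulfI lk); rewrite mulr0 -(row_cofactor3 detJ i k).
by rewrite /dot !cofE; ring.
Qed.

Lemma lam_pderiv l : dot lam (pderiv l H) = 0.
Proof.
have [k uk] := u0; apply: (mulfI uk); rewrite mulr0 -(col_cofactor3 detJ k l).
by rewrite /dot !cofE /pderiv /J /grad; ring.
Qed.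

Lemma lam_u : dot lam u = 0.
Proof. by rewrite -minJ !cofE /dot; ring. Qed.

Lemma J_x i : dot (J i) (@xvec K) = 4%:R * H i.
Proof. by rewrite dotC (euler_dot (homH i)). Qed.

Lemma lam_H : dot lam H = 0.
Proof.
apply: (mulfI four_neq0); rewrite mulr0 -dotZr -(eq_dotr _ J_x) dot_exchange.
by rewrite dotC dot_eq0 // => l; exact: lam_pderiv.
Qed.

Lemma J_square i l : dot (J i) (pderiv l H) = u i * lam l.
Proof. by rewrite -cofE (cofactor3_square _ _ trJ minJ). Qed.

Lemma J_H i : 4%:R * dot (J i) H = u i * dot lam (@xvec K).
Proof.
rewrite -dotZr -(eq_dotr _ J_x) dot_exchange -dotZ.
by rewrite (eq_dot _ (J_square i)) dotZ -dotZ.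
Qed.

(** Both factors are images under [J]: of [x] by Euler's formula, and of a basis vector. The cross
    product of two images is the cofactor matrix, here [lam u^T], applied to the cross product of
    the arguments. *)
Lemma cross_H_pderiv k l :
  4%:R * cross H (pderiv l H) k = lam k * cross u (@xvec K) l.
Proof.
have -> : lam k * cross u (@xvec K) l = cross (cofactor3 J k) (@xvec K) l.
  by rewrite -crossZl; apply: eq_crossl => i; rewrite cofE mulrC.
have -> : 4%:R * cross H (pderiv l H) k =
    cross (fun i => 4%:R * H i) (pderiv l H) k by rewrite crossZl.
have -> : cross (fun i => 4%:R * H i) (pderiv l H) k =
          cross (fun i => dot (J i) (@xvec K)) (pderiv l H) k.
  by apply: eq_crossl => i; rewrite J_x.
rewrite [cofactor3 J k]/cofactor3; elim/ord3P: k => /=;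
  rewrite cross_crossl {1}/cross /= /pderiv /J /grad; ring.
Qed.

(** Rank two enters here: some cofactor row is a nonzero multiple of [u], and it is the cross
    product of two rows of [J] orthogonal to [y]. *)
Lemma J_kernel y : (forall i, dot (J i) y = 0) -> parallel u y.
Proof.
move=> Jy; apply/crossP => l; have [k lk] := lam0.
apply: (mulfI lk); rewrite mulr0 -crossZl.
rewrite (eq_crossl (b := cofactor3 J k)) => [|i]; last by rewrite cofE mulrC.
rewrite /cofactor3; elim/ord3P: k {lk} => /=;
  by rewrite cross_crossl !Jy; ring.
Qed.

Lemma J_left_kernel y : (forall l, dot (pderiv l H) y = 0) -> parallel lam y.
Proof.
move=> Jy; apply/crossP => k; have [l ul] := u0.
apply: (mulfI ul); rewrite mulr0 -crossZl.
rewrite (eq_crossl (b := fun k => cofactor3 J k l)) => [|i]; last by rewrite cofE.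
have colE (a b : 'I_3) : (forall i, cross (pderiv a H) (pderiv b H) i =
    cofactor3 J i l) -> cross (fun i => cofactor3 J i l) y k = 0.
  move=> ab; rewrite -(eq_crossl _ ab) cross_crossl !Jy; ring.
have cc i := cross_columns J i.
elim/ord3P: l {ul} colE => colE.
- by apply: (colE o1 o2) => i; case: (cc i).
- by apply: (colE o2 o0) => i; case: (cc i).
- by apply: (colE o0 o1) => i; case: (cc i).
Qed.

Definition Dlam i := dot u (grad (lam i)).

(* D = sum u_m d_m annihilates H, hence preserves the column space of the
   Jacobian, hence also its left kernel, the line spanned by lam. *)
Lemma lam_Dlam : parallel lam Dlam.
Proof.
apply: J_left_kernel => l.
(* [S] is the second-order term common to two expansions: the derivative of [lam . d_l H = 0] along
   [u], and [lam] contracted with [d_l (J u) = 0]. *)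
pose S := dot u (fun m => dot lam (pderiv m (pderiv l H))).
have eA : dot (pderiv l H) Dlam + S = 0.
  transitivity (dot u (fun m => (dot lam (pderiv l H))^`M(m))).
    rewrite (eq_dotr _ (fun m => mderiv_dot m lam (pderiv l H))).
    by rewrite /S /Dlam /dot /pderiv /grad; ring.
  by apply: dot_eq0 => m; rewrite lam_pderiv mderiv0.
have eB : dot (pderiv l u) (fun m => dot lam (pderiv m H)) + S = 0.
  transitivity (dot lam (fun i => (dot (J i) u)^`M(l))).
    rewrite (eq_dotr _ (fun i => mderiv_dot l (J i) u)).
    rewrite /S /dot /pderiv /J /grad.
    by rewrite !(mderiv_comm l); ring.
  by apply: dot_eq0 => i; rewrite J_u mderiv0.
rewrite (dot_eq0 _ lam_pderiv) add0r in eB.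
by rewrite eB addr0 in eA.
Qed.

(** If [u] were parallel to [x], then [J u = 0] would force [4 H = J x = 0]. *)
Lemma cross_u_x_neq0 : exists i, cross u (@xvec K) i != 0.
Proof.
apply/existsP; apply: contraT; rewrite negb_exists => /forallP e.
have /crossP par : forall i, cross u (@xvec K) i = 0.
  by move=> i; apply/eqP; rewrite -[_ == _]negbK e.
have [i Hi] := H0; have [j uj] := u0; case/negP: Hi.
rewrite -(mulIr_eq0 _ (mulIf uj)) -(mulrI_eq0 _ (mulfI four_neq0)) mulrA -J_x.
have -> : dot (J i) (@xvec K) * u j = dot (J i) u * @xvec K j.
  rewrite /dot !mulrDl -!mulrA (par o0 j) (par o1 j) (par o2 j).
  by rewrite ![u j * _]mulrC.
by rewrite J_u mul0r.
Qed.

(** * Relations between the primitive parts *)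

Section Decomposed.
Variables (h f : P) (d e : nat) (H1 om : 'I_3 -> P).
Local Notation x := (xvec K).
Hypothesis led : (d <= 4)%N.
Hypothesis h0 : h != 0.
Hypothesis hh : h \is (4 - d).-homog.
Hypothesis pH1 : primitive H1.
Hypothesis hH1 : homog_vec d H1.
Hypothesis HE : forall i, H i = h * H1 i.
Hypothesis f0 : f != 0.
Hypothesis pom : primitive om.
Hypothesis hom : homog_vec e om.
Hypothesis omE : forall l, cross u x l = f * om l.

Lemma pderiv_H l i : pderiv l H i = h^`M(l) * H1 i + h * pderiv l H1 i.
Proof. by rewrite /pderiv HE mderivM. Qed.

Lemma lam_H1 : dot lam H1 = 0.
Proof. by apply: (mulfI h0); rewrite mulr0 -dotZr -(eq_dotr _ HE) lam_H. Qed.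

Lemma lam_pderiv_H1 l : dot lam (pderiv l H1) = 0.
Proof.
apply: (mulfI h0); rewrite mulr0 -(lam_pderiv l) (eq_dotr _ (pderiv_H l)).
transitivity (h^`M(l) * dot lam H1 + h * dot lam (pderiv l H1)).
  by rewrite lam_H1 mulr0 add0r.
by rewrite /dot; ring.
Qed.

Lemma cross_H1_pderiv_sq k l :
  h * h * (4%:R * cross H1 (pderiv l H1) k) = f * om l * lam k.
Proof.
rewrite -omE [RHS]mulrC -cross_H_pderiv.
have -> : cross H (pderiv l H) k = cross (fun i => h * H1 i)
    (fun i => h^`M(l) * H1 i + h * pderiv l H1 i) k.
  rewrite (eq_crossl _ HE); apply: eq_cross; exact: pderiv_H.
by elim/ord3P: k; rewrite /cross /=; ring.
Qed.

(** The derivative of [h] drops out of the cross product of [H] with its derivative, which is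
    therefore divisible by [h^2]; primitivity of [om] and [lam] moves this divisor to [f]. *)
Lemma square_factor : exists tau, f = h * h * tau.
Proof.
have : divides (h * h) f; last by case=> tau; exists tau.
apply: pom => l; apply: plam => k.
by exists (4%:R * cross H1 (pderiv l H1) k); rewrite cross_H1_pderiv_sq.
Qed.

(** Both [lam] and its derivatives are orthogonal to [H1], so their cross product is a multiple
    [th l] of [H1]. Euler's formula gives [th . x = 0] and [lam_Dlam] gives [th . u = 0], so [th] is
    parallel to [cross u x], hence a multiple of [om]. *)
Lemma theta_exists : exists sig, forall l k,
  cross lam (pderiv l lam) k = sig * om l * H1 k.
Proof.
have [th thE] : exists th : 'I_3 -> P, forall l, forall k,
    cross lam (pderiv l lam) k = th l * H1 k.
  apply: (fin_all_exists (P := fun l (a : P) => forall k,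
    cross lam (pderiv l lam) k = a * H1 k)) => l.
  apply: primitive_parallel => //; apply: parallelC.
  apply/crossP => k; rewrite cross_crossl lam_H1.
  have := mderiv_dot l lam H1; rewrite lam_H1 lam_pderiv_H1 mderiv0 addr0 => <-.
  by rewrite !mulr0 subrr.
have [i H1i] := primitive_neq0 pH1.
have th_dot w : (forall k, dot w (fun l => cross lam (pderiv l lam) k) = 0) ->
    dot th w = 0.
  move=> e0; apply: (mulIf H1i); rewrite mul0r -(e0 i) /dot !thE; ring.
have th_x : dot th x = 0.
  apply: th_dot => k.
  transitivity (cross lam (fun i => dot x (grad (lam i))) k).
    by elim/ord3P: k; rewrite /cross /dot /pderiv /grad /=; ring.
  rewrite (eq_cross _ (fun i => euler_dot (hlam i))) crossZ.
  by rewrite crossvv mulr0.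
have th_u : dot th u = 0.
  apply: th_dot => k.
  transitivity (cross lam Dlam k); last first.
    by move: k; apply/crossP; exact: lam_Dlam.
  by elim/ord3P: k; rewrite /cross /Dlam /dot /pderiv /grad /=; ring.
have [|sig thE'] := primitive_parallel (v := th) pom.
  apply: parallelC; apply/crossP => k; apply: (mulfI f0).
  rewrite mulr0 -crossZ -(eq_cross _ omE) cross_crossr th_x th_u; ring.
by exists sig => l k; rewrite thE thE'.
Qed.

Lemma om_x : dot om x = 0.
Proof.
by apply: (mulfI f0); rewrite mulr0 -dotZ -(eq_dot _ omE) dot_crossr.
Qed.

Lemma e_gt0 : (0 < e)%N.
Proof.
rewrite lt0n; apply/eqP => e0; have [l] := primitive_neq0 pom; case/eqP.
have := mderiv_dot l om x; rewrite om_x mderiv0 dot_pderiv_xvec => ->.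
rewrite dotC dot_eq0 ?add0r // => i.
by rewrite /pderiv mderiv_homog0 //; have := hom i; rewrite e0.
Qed.

Local Notation L := (dot lam x).
Local Notation Q := (dot H1 om).

Lemma u_L i : u i * L = f * cross lam om i.
Proof.
by rewrite -crossZ -(eq_cross _ omE) cross_crossr lam_u mulr0 subr0.
Qed.

Lemma cross_H_u k : L * cross H u k = f * h * Q * lam k.
Proof.
have H_om : dot H om = h * Q by rewrite -dotZ; apply: eq_dot.
have lamH : dot H lam = 0 by rewrite dotC lam_H.
rewrite -crossZ (eq_cross H (b := fun i => f * cross lam om i)); last first.
  by move=> i; rewrite mulrC u_L.
by rewrite crossZ cross_crossr H_om lamH; ring.
Qed.

(** * Degree bounds for nonzero [sig] *)

Section NonzeroTheta.
Variables tau sig : P.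
Hypothesis ftau : f = h * h * tau.
Hypothesis sigE : forall l k, cross lam (pderiv l lam) k = sig * om l * H1 k.
Hypothesis sig0 : sig != 0.

Lemma tauE l k : 4%:R * cross H1 (pderiv l H1) k = tau * om l * lam k.
Proof.
apply: (mulfI (mulf_neq0 h0 h0)).
by rewrite cross_H1_pderiv_sq ftau !mulrA.
Qed.

Lemma tau0 : tau != 0.
Proof. by apply: contraNneq f0 => t0; rewrite ftau t0 mulr0. Qed.

(** [s] is the degree of [sig]. The truncated predecessor is harmless: [dl = 0] would give [e = 0],
    against [e_gt0]. *)
Lemma degree_sig : exists s, (s + e + d = dl + dl.-1)%N.
Proof.
have [l oml] := primitive_neq0 pom; have [k H1k] := primitive_neq0 pH1.
have nz : om l * H1 k != 0 by rewrite mulf_neq0.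
have [||s [les hs ho]] := @dhomog_factor _ _ (dl + dl.-1) sig (om l * H1 k).
- by rewrite mulf_neq0.
- rewrite mulrA -sigE; apply: cross_homog => //; exact: pderiv_homog.
exists s; move: les (dhomog_uniq nz ho (dhomogM (hom l) (hH1 k))).
by clear; lia.
Qed.

Lemma degree_tau : exists t, (t + e + dl = d + d.-1)%N.
Proof.
have [l oml] := primitive_neq0 pom; have [k lamk] := lam0.
have nz : om l * lam k != 0 by rewrite mulf_neq0.
have [||s [les hs ho]] := @dhomog_factor _ _ (d + d.-1) tau (om l * lam k).
- by rewrite mulf_neq0 // tau0.
- rewrite mulrA -tauE; apply: scale_homog; apply: cross_homog => //.
  exact: pderiv_homog.
exists s; move: les (dhomog_uniq nz ho (dhomogM (hom l) (hlam k))).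
by clear; lia.
Qed.

(** By [u_L], vanishing of [L] would make [om] a multiple of [lam], so [dl <= e], against the two
    degree relations. *)
Lemma L_neq0 : L != 0.
Proof.
apply/eqP => L0; have par : parallel lam om.
  apply/crossP => k; apply: (mulfI f0).
  by rewrite mulr0 -u_L L0 mulr0.
have := primitive_parallel_le plam hlam hom par (primitive_neq0 pom).
have [s es] := degree_sig; have [t et] := degree_tau.
by move: e_gt0 es et; clear; lia.
Qed.

(** Otherwise [H] is parallel to [u], so [J H = 0], whereas [4 J H = L u] is nonzero. *)
Lemma Q_neq0 : Q != 0.
Proof.
apply/eqP => Q0; have par : parallel H u.
  apply/crossP => k; apply: (mulfI L_neq0).
  by rewrite cross_H_u Q0 mulr0 mul0r mulr0.
have [j uj] := u0.
have JH i : dot (J i) H = 0.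
  apply: (mulIf uj); rewrite mul0r.
  transitivity (dot (J i) u * H j); last by rewrite J_u mul0r.
  rewrite /dot !mulrDl -!mulrA (par o0 j) (par o1 j) (par o2 j).
  by rewrite ![H j * _]mulrC.
have /eqP := J_H j; rewrite JH mulr0 eq_sym mulf_eq0 (negbTE uj) /=.
by rewrite (negbTE L_neq0).
Qed.

Lemma L_H_neq0 : exists k, cross H u k != 0.
Proof.
have [k lamk] := lam0; exists k; apply: contraTneq lamk => c0.
have /eqP := cross_H_u k; rewrite c0 mulr0 eq_sym !mulf_eq0.
by rewrite (negbTE f0) (negbTE h0) (negbTE Q_neq0) /= => /eqP ->; rewrite eqxx.
Qed.

(* As a vector in i, the difference of the two sides is parallel to u and its
   cross product with H vanishes. *)
Lemma jacobian_formula i l :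
  4%:R * h * Q * (L * J i l - 4%:R * lam l * H i) = L * L * om l * u i.
Proof.
pose Y i := L * J i l - 4%:R * lam l * H i.
pose Z i := 4%:R * h * Q * Y i - L * L * om l * u i.
suff : Z i = 0 by move/subr0_eq.
have uY : parallel u Y.
  apply: J_kernel => j.
  transitivity (L * dot (J j) (pderiv l H) - lam l * (4%:R * dot (J j) H)).
    by rewrite /Y /dot /pderiv /J /grad; ring.
  by rewrite J_square J_H; ring.
have [k Hu] := L_H_neq0.
apply: (parallel_both (k := k) _ _ Hu).
  apply/crossP => m.
  transitivity (h * Q * (L * (4%:R * cross H (pderiv l H) m))
     - L * om l * (L * cross H u m)).
    rewrite /Z /Y /pderiv /J /grad.
    by elim/ord3P: m; rewrite /cross /=; ring.
  by rewrite cross_H_pderiv cross_H_u omE; ring.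
move=> j m; rewrite /Z; have := uY j m.
transitivity (4%:R * h * Q * (u j * Y m) - L * L * om l * u m * u j); first by ring.
by rewrite uY; ring.
Qed.

(** A factor [L] is extracted twice. Modulo [L], [F] leaves [16 h Q lam_l H1_i], so [16 h Q = L k].
    Multiplying [F] by [4 h] turns [h^2 tau (lam x om)] into [L u], which yields [L | 4 h k]. The
    constant is 64 = 4 * 16. *)
Lemma L_square_dvd : exists j, L * L * j = 64%:R * (h * h * Q).
Proof.
have F i l : 4%:R * Q * (L * J i l - 4%:R * h * lam l * H1 i) =
    L * tau * h * cross lam om i * om l.
  apply: (mulfI h0).
  transitivity (4%:R * h * Q * (L * J i l - 4%:R * lam l * H i)).
    by rewrite HE; ring.
  rewrite jacobian_formula -mulrA mulrCA mulrAC [om l * _]mulrC.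
  transitivity (L * om l * (u i * L)); first by ring.
  by rewrite u_L ftau; ring.
have [k hQk] : divides L (16%:R * (h * Q)).
  apply: plam => l; apply: pH1 => i.
  exists (4%:R * Q * J i l - tau * h * cross lam om i * om l).
  transitivity (4%:R * Q * (L * J i l) -
    4%:R * Q * (L * J i l - 4%:R * h * lam l * H1 i)); first by ring.
  by rewrite F; ring.
have [j hkj] : divides L (4%:R * (h * k)).
  apply: plam => l; apply: pH1 => i.
  exists (k * J i l - 4%:R * u i * om l).
  apply: (mulfI L_neq0).
  transitivity (4%:R * h * (L * k) * lam l * H1 i); first by ring.
  rewrite -hQk.
  transitivity (16%:R * (h * Q) * L * J i l -
    4%:R * h * (4%:R * Q * (L * J i l - 4%:R * h * lam l * H1 i))).
    by ring.
  rewrite F hQk.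
  transitivity (L * k * L * J i l -
    4%:R * L * (h * h * tau * cross lam om i) * om l); first by ring.
  by rewrite -ftau -u_L; ring.
exists j; rewrite -mulrA -hkj.
transitivity (4%:R * h * (L * k)); first by ring.
by rewrite -hQk; ring.
Qed.

Lemma degrees : [/\ d = 2%N, e = 1%N, (0 < dl)%N & (4 - d = 2)%N].
Proof.
have [j Lj] := L_square_dvd.
have n64 : 64%:R != 0 :> P.
  by rewrite (_ : 64%N = 4 ^ 3)%N // natrX expf_neq0 // four_neq0.
have [||s [les hs hj]] := @dhomog_factor _ _ (4 - d + (4 - d) + (d + e)) (L * L) j.
- by rewrite Lj !mulf_neq0 // Q_neq0.
- rewrite Lj; apply: scale_homog; apply: dhomogM; first exact: dhomogM.
  exact: dot_homog.
have hL := dot_homog hlam (@xvec_homog K).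
have := dhomog_uniq (mulf_neq0 L_neq0 L_neq0) hs (dhomogM hL hL).
have [s' es] := degree_sig; have [t et] := degree_tau.
by move: e_gt0 es et les led; clear => *; split; lia.
Qed.

(** * The remaining case: linear [om] *)

Section Linear.
Hypothesis d2 : d = 2%N.
Hypothesis e1 : e = 1%N.
Hypothesis dl0 : (0 < dl)%N.
Hypothesis dh2 : (4 - d = 2)%N.

(** Differentiating [om . x = 0] twice shows that the matrix of the linear map [om] is skew, with
    zero diagonal as 2 is invertible. A skew 3 x 3 matrix is the cross product with a fixed
    vector. *)
Lemma om_cross : exists gam : 'I_3 -> K,
  forall l, om l = cross (fun i => (gam i)%:MP) x l.
Proof.
have hD m n : ((om n)^`M(m))%R \is 0.-homog.
  by have := mderiv_homog m (hom n); rewrite e1.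
have DE m n : (om n)^`M(m) = (((om n)^`M(m))@_0)%:MP by exact/dhomog0E/hD.
exists (fun i => match val i with
  | 0 => ((om o2)^`M(o1))@_0
  | 1 => ((om o0)^`M(o2))@_0
  | _ => ((om o1)^`M(o0))@_0
  end) => l.
have skew m n : (om m)^`M(n) + (om n)^`M(m) = 0.
  have := mderiv_dot m om x; rewrite om_x mderiv0 dot_pderiv_xvec => e0.
  have := congr1 (mderiv n) e0; rewrite mderiv0 mderivD mderiv_dot dot_pderiv_xvec.
  have -> : dot (pderiv n (pderiv m om)) x = 0.
    by rewrite dotC dot_eq0 // => i; rewrite /pderiv mderiv_homog0.
  by rewrite add0r addrC => <-.
have skew' m n : (om n)^`M(m) = - (om m)^`M(n).
  by apply/eqP; rewrite -addr_eq0 skew.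
have diag m : (om m)^`M(m) = 0.
  apply: (@mulr_natP K 2) => //; rewrite -(skew m m); ring.
have eul := euler_dot (hom l); rewrite e1 mul1r in eul; rewrite -eul.
elim/ord3P: l {eul}; rewrite /cross /dot /grad /= -!DE !diag.
- by rewrite (skew' o1 o0); ring.
- by rewrite (skew' o2 o1); ring.
- by rewrite (skew' o0 o2); ring.
Qed.

Lemma dependent_linear : dependent H.
Proof.
have [gam omc] := om_cross.
pose c i : P := (gam i)%:MP.
(* Contracting [tauE] and [sigE] over [l] with [c] kills the right-hand sides, because [om . c = 0].
   So [H1] and [lam] are parallel to their derivatives along [c], which must vanish for degree
   reasons. *)
pose dc (g : P) := dot c (grad g).
have dc0 g : g \is 0.-homog -> dc g = 0.
  by move=> hg; rewrite /dc dot_eq0 // => i; rewrite /grad mderiv_homog0.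
have dcM g1 g2 : dc (g1 * g2) = dc g1 * g2 + g1 * dc g2.
  by rewrite /dc /dot /grad !mderivM; ring.
have dcn (m : nat) g : dc (m%:R * g) = m%:R * dc g.
  by rewrite dcM dc0 ?natr_homog // mul0r add0r.
have dcD g1 g2 : dc (g1 + g2) = dc g1 + dc g2.
  by rewrite /dc /dot /grad !mderivD; ring.
have hdc m g : g \is m.+1.-homog -> dc g \is m.-homog.
  move=> hg; rewrite -[m]add0n; apply: dot_homog => i.
    exact: mpolyC_homog.
  exact: mderiv_homogS.
have dcc i : dc (c i) = 0 by apply/dc0/mpolyC_homog.
have om_c : dot om c = 0 by rewrite (eq_dot _ omc) dot_crossl.
have dcv m v : primitive v -> homog_vec m.+1 v ->
    (forall k, cross v (fun i => dc (v i)) k = 0) -> forall i, dc (v i) = 0.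
  move=> pv hv /crossP par i; apply/eqP; apply: contraT => nz.
  have := primitive_parallel_le pv hv (fun i => hdc _ _ (hv i)) par (ex_intro _ i nz).
  by rewrite ltnn.
have dcH1 i : dc (H1 i) = 0.
  apply: (dcv 1%N) => //; first by rewrite -d2.
  move=> k; apply: (mulfI four_neq0).
  transitivity (dot (fun l => 4%:R * cross H1 (pderiv l H1) k) c).
    by elim/ord3P: k; rewrite /cross /dc /dot /pderiv /grad /=; ring.
  rewrite (eq_dot _ (fun l => tauE l k)).
  transitivity (tau * lam k * dot om c); first by rewrite /dot; ring.
  by rewrite om_c !mulr0.
have dclam i : dc (lam i) = 0.
  apply: (dcv dl.-1) => //; first by rewrite prednK.
  move=> k; transitivity (dot (fun l => cross lam (pderiv l lam) k) c).
    by elim/ord3P: k; rewrite /cross /dc /dot /pderiv /grad /=; ring.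
  rewrite (eq_dot _ (fun l => sigE l k)).
  transitivity (sig * H1 k * dot om c); first by rewrite /dot; ring.
  by rewrite om_c mulr0.
pose bet := dot lam c.
(* [E = u - f c] is parallel to [x], since [u] and [f c] have the same cross product with [x].
   Comparing [J E] with [J x = 4 H] expresses [4 h E] as a multiple of [x], which is then contracted
   with [lam]. *)
have Lh : L * dc h = 4%:R * (h * bet).
  pose E i := u i - f * c i.
  have parE : parallel E x.
    apply/crossP => l; transitivity (cross u x l - f * cross c x l).
      by elim/ord3P: l; rewrite /E /cross /=; ring.
    by rewrite omE omc subrr.
  have JE i : dot (J i) E = - (f * dc h * H1 i).
    have -> : dot (J i) E = dot (J i) u - f * dc (H i).
      by rewrite /E /dc /dot /J; ring.
    by rewrite J_u HE dcM dcH1; ring.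
  have [i H1i] := primitive_neq0 pH1.
  have hE j : 4%:R * h * E j = - (f * dc h * x j).
    apply: (mulfI H1i); transitivity (4%:R * H i * E j); first by rewrite HE; ring.
    rewrite -J_x; transitivity (dot (J i) E * x j); last by rewrite JE; ring.
    rewrite /dot !mulrDl -!mulrA (parE o0 j) (parE o1 j) (parE o2 j).
    by rewrite ![x _ * E j]mulrC.
  have lamE : dot lam E = - (f * bet).
    have -> : dot lam E = dot lam u - f * bet by rewrite /E /bet /dot; ring.
    by rewrite lam_u sub0r.
  apply: (mulfI f0).
  transitivity (- dot lam (fun j => - (f * dc h * x j))); first by rewrite /dot; ring.
  rewrite -(eq_dotr _ hE) dotZr lamE; ring.
have dcL : dc L = bet.
  transitivity (dot (fun i => dc (lam i)) x + dot lam (fun i => dc (x i))).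
    by rewrite /dc /dot /grad !mderivD !mderivM; ring.
  rewrite dotC (dot_eq0 _ dclam) add0r; apply: eq_dotr => i.
  rewrite /dc -(dot_pderiv_xvec i c); apply: eq_dotr => j.
  rewrite /grad -[(x i)^`M(j)]/(pderiv j x i) -[RHS]/(pderiv i x j).
  by rewrite !pderiv_xvec eq_sym.
have dcbet : dc bet = 0.
  transitivity (dot (fun i => dc (lam i)) c + dot lam (fun i => dc (c i))).
    by rewrite /dc /dot /grad !mderivD !mderivM; ring.
  by rewrite dotC (dot_eq0 _ dclam) (dot_eq0 _ dcc) addr0.
have hh2 : h \is 2.-homog by have := hh; rewrite dh2.
have dc3h : dc (dc (dc h)) = 0 by apply/dc0/hdc/hdc.
(* As [dc L = bet] and [dc bet = 0], each differentiation of [Lh] along [c] lowers the constant 4 by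
   one. Since [h] has degree 2, the third derivative vanishes; for nonzero [bet], so would
   successively [dc (dc h)], [dc h] and [h]. *)
have bet0 : bet = 0.
  have E2 : L * dc (dc h) = 3%:R * (dc h * bet).
    have := congr1 dc Lh; rewrite (dcM L) dcn dcM dcL dcbet => E.
    transitivity (bet * dc h + L * dc (dc h) - bet * dc h); first by ring.
    by rewrite E; ring.
  have E3 : 2%:R * (dc (dc h) * bet) = 0.
    have := congr1 dc E2; rewrite dcM dcn dcM dcL dcbet dc3h => E.
    transitivity (3%:R * (dc (dc h) * bet + dc h * 0) -
      (bet * dc (dc h) + L * 0)); first by ring.
    by rewrite E; ring.
  have step (m : nat) (g : P) :
      m%:R != 0 :> K -> m%:R * (g * bet) = 0 -> bet != 0 -> g = 0.
    move=> m0 /(mulr_natP m0) /eqP; rewrite mulf_eq0.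
    by move=> /orP[/eqP //|/eqP ->]; rewrite eqxx.
  apply/eqP; apply: contraT => b0.
  have z2 := step _ _ char2 E3 b0.
  have z1 : dc h = 0 by apply: (step 3%N) => //; rewrite -E2 z2 mulr0.
  by case/eqP: h0; apply: (step 4%N) => //; [exact: char_small | rewrite -Lh z1 mulr0].
(* Now [lam] and its derivatives are all orthogonal to [c], so their cross product [sig om_l H1] is
   parallel to [c]. *)
have parH1 : parallel H1 c.
  apply/crossP => k; have [l oml] := primitive_neq0 pom.
  apply: (mulfI (mulf_neq0 sig0 oml)); rewrite mulr0 -crossZl.
  rewrite (eq_crossl (b := cross lam (pderiv l lam))) => [|i]; last by rewrite sigE.
  rewrite cross_crossl -/bet bet0.
  have := mderiv_dot l lam c; rewrite -/bet bet0 mderiv0.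
  rewrite [dot lam (pderiv l c)]dot_eq0 => [|i]; last exact: mderivC.
  by rewrite addr0 => <-; rewrite !mulr0 subrr.
apply: (dependent_const (gam := gam)).
  have [l oml] := primitive_neq0 pom.
  apply/existsP; apply: contraT; rewrite negb_exists => /forallP g0.
  case/eqP: oml; rewrite omc.
  have c0 i : (gam i)%:MP_[3] = 0 by have /negPn/eqP -> := g0 i; rewrite mpolyC0.
  by elim/ord3P: l; rewrite /cross /= !c0; ring.
by move=> i j; rewrite !HE -!mulrA [H1 i * _]parH1.
Qed.

End Linear.
End NonzeroTheta.
End Decomposed.

Lemma dependent_factored : dependent H.
Proof.
have [h [d [H1 [[led h0 hh] [pH1 hH1 HE]]]]] := primitive_part homH H0.
have [f [e [om [[lee f0 hf] [pom hom omE]]]]] :=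
  primitive_part (cross_homog hu (@xvec_homog K)) cross_u_x_neq0.
have [tau ftau] := square_factor HE pom omE.
have [sig sigE] := theta_exists h0 pH1 HE f0 pom omE.
have [sig_eq0|sig0] := eqVneq sig 0.
  apply: (dependent_pderiv0 char2 char3 homH lam0) lam_H => l.
  apply: (primitive_pderiv plam hlam); apply/crossP => k.
  by rewrite sigE sig_eq0 !mul0r.
have [d2 e1 dl0 dh2] :=
  degrees led h0 hh pH1 hH1 HE f0 pom hom omE ftau sigE sig0.
exact: (dependent_linear h0 hh pH1 hH1 HE f0 pom hom omE ftau sigE sig0 d2 e1 dl0 dh2).
Qed.

End Factored.

Theorem dependent_of_char_poly (H : 'I_3 -> P) (J := fun i => grad (H i)) :
  homog_vec 4 H ->
  J o0 o0 + J o1 o1 + J o2 o2 = 0 ->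
  cofactor3 J o0 o0 + cofactor3 J o1 o1 + cofactor3 J o2 o2 = 0 ->
  det3 J = 0 -> dependent H.
Proof.
move=> homH trJ minJ detJ.
have [/existsP H0|] := boolP [exists i, H i != 0]; last first.
  rewrite negb_exists => /forallP H0.
  exists (fun=> 1); split; first by exists o0; exact: oner_neq0.
  by rewrite big1 // => i _; have /negPn/eqP -> := H0 i; rewrite scaler0.
have hC k : homog_vec 6 (cofactor3 J k).
  have hJ i : homog_vec 3 (J i) by move=> l; exact: mderiv_homogS.
  by elim/ord3P: k; exact: (cross_homog (hJ _) (hJ _)).
have [/existsP[k /existsP[l C0]]|] := boolP [exists k, exists l, cofactor3 J k l != 0].
  have [|dl [du [lam [u [dlu plam hlam hu CE]]]]] :=
    rank_one_factor hC (cofactor3_parallel detJ) .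
    by exists k, l.
  apply: (dependent_factored homH trJ minJ detJ H0 plam hlam hu CE).
  by exists l; apply: contraNneq C0 => u0; rewrite CE u0 mul0r.
rewrite negb_exists => /forallP C0.
have {}C0 k l : cofactor3 J k l = 0.
  have := C0 k; rewrite negb_exists => /forallP /(_ l).
  by rewrite negbK => /eqP.
(* Rank at most one: [4 cross(H, d_l H)] is built from cofactors, so it vanishes and [H] is parallel
   to its derivatives. *)
have [|h [gam [gam0 HE]]] := parallel_derivs_const char2 char3 (leqnn 4) homH H0.
  move=> l; apply/crossP => k.
  have n4 : 4%:R != 0 :> P by apply: natP_neq0; exact: char_small.
  apply: (mulfI n4); rewrite mulr0 -crossZl.
  rewrite (eq_crossl (b := fun i => dot (J i) (@xvec K))) => [|i]; last first.
    by rewrite dotC (euler_dot (homH i)).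
  transitivity (cross (cofactor3 J k) (@xvec K) l).
    rewrite [cofactor3 J k]/cofactor3; elim/ord3P: k => /=;
    rewrite cross_crossl {1}/cross /= /pderiv /J /grad; ring.
  by rewrite /cross !C0; elim/ord3P: l => /=; ring.
apply: (dependent_const gam0) => i j.
by rewrite !HE; ring.
Qed.

End Dependence.

(** * Nilpotent planar Jacobians *)

Section Planar.
Variable K : fieldType.
Hypothesis char2 : 2%:R != 0 :> K.
Hypothesis char3 : 3%:R != 0 :> K.
Local Notation P := {mpoly K[3]}.
Implicit Types (p q w : 'I_3 -> K) (f g A B : P).

Definition ddir p f := dot (fun i => (p i)%:MP) (grad f).

Lemma ddirM p f g : ddir p (f * g) = ddir p f * g + f * ddir p g.
Proof. by rewrite /ddir /dot /grad !mderivM; ring. Qed.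

Lemma ddirD p f g : ddir p (f + g) = ddir p f + ddir p g.
Proof. by rewrite /ddir /dot /grad !mderivD; ring. Qed.

Lemma ddirN p f : ddir p (- f) = - ddir p f.
Proof. by rewrite /ddir /dot /grad !mderivN; ring. Qed.

Lemma ddirZ p a f : ddir p (a *: f) = a%:MP * ddir p f.
Proof. by rewrite /ddir /dot /grad !mderivZ -!mul_mpolyC; ring. Qed.

Lemma ddirC p q f : ddir p (ddir q f) = ddir q (ddir p f).
Proof.
rewrite /ddir /dot /grad !mderivD !mderivM !mderivC.
by rewrite (mderiv_comm o0 o1) (mderiv_comm o0 o2) (mderiv_comm o1 o2); ring.
Qed.

Lemma ddir_homog p d f : f \is d.+1.-homog -> ddir p f \is d.-homog.
Proof.
move=> hf; rewrite -[d]add0n; apply: dot_homog => i; first exact: mpolyC_homog.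
exact: mderiv_homogS.
Qed.

Lemma ddir_const p f : f \is 0.-homog -> ddir p f = 0.
Proof. by move=> hf; apply: dot_eq0 => i; rewrite /grad mderiv_homog0. Qed.

Lemma divides_homog_le d e f g : f \is d.-homog -> g \is e.-homog ->
  g != 0 -> divides f g -> (d <= e)%N.
Proof.
move=> hf hg g0 [q gE]; have fq0 : f * q != 0 by rewrite -gE.
have f0 : f != 0 by apply: contraNneq fq0 => ->; rewrite mul0r.
have [|s [les hf' _]] := @dhomog_factor _ _ e _ _ fq0; first by rewrite -gE.
by rewrite (dhomog_uniq f0 hf hf').
Qed.

Section NilpotentPair.
Variables (p q w : 'I_3 -> K) (A B : P).
Hypothesis span : forall f, ddir p f = 0 -> ddir q f = 0 -> ddir w f = 0 ->
  forall l, f^`M(l) = 0.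
Hypothesis homA : A \is 4.-homog.
Hypothesis trAB : ddir p A + ddir q B = 0.
Hypothesis detAB : ddir p A * ddir q B = ddir q A * ddir p B.

Lemma linear_constant f : f \is 1.-homog ->
  ddir p f = 0 -> ddir q f = 0 -> ddir w f = 0 -> f = 0.
Proof.
move=> hf fp fq fw; have := euler_dot hf; rewrite mul1r => <-.
by apply: dot_eq0 => i; apply: span.
Qed.

(* The kernel of the planar Jacobian is spanned by (be, - al). *)
Lemma no_linear_kernel F al be : F != 0 -> F \is 1.-homog ->
  al \is 1.-homog -> be \is 1.-homog -> be != 0 ->
  (forall a b, divides a (b * al) -> divides a (b * be) -> divides a b) ->
  ddir p A = F * al * be -> ddir q A = F * be * be ->
  ddir p B = - (F * al * al) -> ddir q B = - (F * al * be) -> False.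
Proof.
move=> F0 hF hal hbe be0 prim ApE AqE BpE BqE.
have unit_be : ~ divides be 1.
  move=> be1; have := divides_homog_le hbe (dhomog1 _ _) (oner_neq0 _) be1.
  by rewrite ltnn.
have al0 : al != 0.
  apply/eqP => al0; apply: unit_be; apply: (prim).
    by rewrite al0 mulr0; exact: divides0.
  by exists 1; rewrite mulrC.
have c0 r f : f \is 1.-homog -> ddir r f \is 0.-homog by exact: ddir_homog.
have cc r s f : f \is 1.-homog -> ddir r (ddir s f) = 0.
  by move=> hf; apply/ddir_const/c0.
have small f g : g \is 1.-homog -> f \is 0.-homog -> divides g f -> f = 0.
  move=> hg hf gf; apply/eqP; apply: contraT => f0.
  by have := divides_homog_le hg hf f0 gf; rewrite ltnn.
have E1 := ddirC q p A; rewrite ApE AqE !ddirM in E1.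
have E2 := ddirC q p B; rewrite BpE BqE !ddirN !ddirM in E2.
(* [al] times the commutation identity for [A] plus [be] times the one for [B]; the derivatives of
   [F] cancel. *)
have key : al * al * ddir q be + ddir p al * be * be
    = al * be * (ddir q al + ddir p be).
  apply: (mulfI F0); apply/eqP; rewrite -subr_eq0; apply/eqP.
  have /eqP := E1; rewrite -subr_eq0 => /eqP E1'.
  have /eqP := E2; rewrite -subr_eq0 => /eqP E2'.
  transitivity (al * 0 + be * 0 : P); last by ring.
  by rewrite -{1}E1' -E2'; ring.
have beq : ddir q be = 0.
  apply: (small _ be) => //; first exact: c0.
  apply: (prim); last by exists (ddir q be); rewrite mulrC.
  apply: (prim); last by exists (ddir q be * al); ring.
  exists (al * (ddir q al + ddir p be) - ddir p al * be).
  transitivity (al * al * ddir q be + ddir p al * be * be -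
    ddir p al * be * be); first by ring.
  by rewrite key; ring.
have key2 : ddir p al * be = al * (ddir q al + ddir p be).
  apply: (mulIf be0); move: key; rewrite beq mulr0 add0r => ->; ring.
have alp : ddir p al = 0.
  apply: (small _ al) => //; first exact: c0.
  apply: (prim); first by exists (ddir p al); rewrite mulrC.
  by exists (ddir q al + ddir p be).
have bep : ddir p be = - ddir q al.
  apply/eqP; rewrite -addr_eq0 addrC; apply/eqP; apply: (mulfI al0).
  by rewrite -key2 alp mul0r mulr0.
set k := ddir q al in E1 E2 key key2 bep.
have E3 : 3%:R * (k * F) = ddir p F * be - ddir q F * al.
  apply: (mulIf be0); apply/eqP; rewrite -subr_eq0; apply/eqP.
  have /eqP := E1; rewrite -subr_eq0 => /eqP <-.
  by rewrite beq bep; ring.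
have pk : ddir p k = 0 by exact: cc.
have qk : ddir q k = 0 by exact: cc.
have d3 r : ddir r (3%:R : P) = 0.
  by apply: ddir_const; exact: natr_homog.
(* [F] is linear, so differentiating [E3] along [p] and [q] gives [4 k ddir p F = 0] and
   [4 k ddir q F = 0]; then [E3] itself reads [3 k F = 0]. *)
have k0 : k = 0.
  apply/eqP; apply: contraT => kn0; case/eqP: F0; apply: (mulfI kn0).
  rewrite mulr0; apply: (mulr_natP char3); rewrite E3.
  suff [-> ->] : ddir p F = 0 /\ ddir q F = 0 by ring.
  have four : 4%:R != 0 :> K by exact: char_small.
  split; apply: (mulfI kn0); rewrite mulr0; apply: (mulr_natP four).
    have := congr1 (ddir p) E3.
    rewrite (ddirM p 3%:R) d3 (ddirM p k) pk ddirD ddirN !ddirM.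
    rewrite alp bep !(cc _ _ _ hF) => e.
    apply/eqP; rewrite -subr_eq0; apply/eqP.
    transitivity (0 * (k * F) + 3%:R * (0 * F + k * ddir p F) -
      (0 * be + ddir p F * - k - (0 * al + ddir q F * 0))); first by ring.
    by rewrite e; ring.
  have := congr1 (ddir q) E3.
  rewrite (ddirM q 3%:R) d3 (ddirM q k) qk ddirD ddirN !ddirM.
  rewrite -/k beq !(cc _ _ _ hF) => e.
  apply/eqP; rewrite -subr_eq0; apply/eqP.
  transitivity (0 * (k * F) + 3%:R * (0 * F + k * ddir q F) -
    (0 * be + ddir p F * 0 - (0 * al + ddir q F * k))); first by ring.
  by rewrite e; ring.
(* [al] and [be] now vary only along [w], so they are proportional linear forms, which contradicts
   their coprimality. *)
have albe : ddir w al * be - ddir w be * al = 0.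
  apply: linear_constant.
  - apply: dhomogB; first exact: (dhomogM (c0 w al hal) hbe).
    exact: (dhomogM (c0 w be hbe) hal).
  - by rewrite ddirD ddirN !ddirM !cc // alp bep k0; ring.
  - by rewrite ddirD ddirN !ddirM !cc // -/k beq k0; ring.
  - by rewrite ddirD ddirN !ddirM !cc //; ring.
have bew : ddir w be = 0.
  apply: (small _ be) => //; first exact: c0.
  apply: (prim); last by exists (ddir w be); rewrite mulrC.
  exists (ddir w al); rewrite mulrC [RHS]mulrC.
  by apply/esym/subr0_eq; rewrite -albe; ring.
by case/eqP: be0; apply: linear_constant => //; rewrite bep k0 oppr0.
Qed.

(** Nilpotency gives [(ddir p A)^2 = - ddir q A * ddir p B]. Writing the derivatives of [A] along
    [p] and [q] as [h al] and [h be] with [al], [be] coprime of degree [d], it follows that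
    [be | h], whence [2 d <= 3]. For [d = 0] the constants [al], [be] serve as [y], [z]; [d = 1] is
    excluded by [no_linear_kernel]. *)
Lemma nilpotent_pair : exists y z : K, ((y != 0) || (z != 0)) /\
  ddir p (y *: A + z *: B) = 0 /\ ddir q (y *: A + z *: B) = 0.
Proof.
have BqE : ddir q B = - ddir p A by apply/eqP; rewrite -addr_eq0 addrC trAB.
have hAp : ddir p A \is 3.-homog by exact: ddir_homog.
have hAq : ddir q A \is 3.-homog by exact: ddir_homog.
have det : ddir p A * ddir p A = - (ddir q A * ddir p B).
  by rewrite -detAB BqE mulrN opprK.
have [Aq0|Aq0] := eqVneq (ddir q A) 0.
  exists 1, 0; rewrite oner_neq0; split=> //.
  rewrite scale1r scale0r addr0; split=> //.
  by apply/eqP; rewrite -sqrf_eq0 expr2 det Aq0 mul0r oppr0.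
pose v (i : 'I_3) : P := match val i with 0 => ddir p A | 1 => ddir q A | _ => 0 end.
have hv : homog_vec 3 v by elim/ord3P => //=; exact: dhomog0.
have [|h [d [W [[led h0 hh] [pW hW vW]]]]] := primitive_part hv.
  by exists o1.
set al := W o0; set be := W o1.
have ApE : ddir p A = h * al := vW o0.
have AqE : ddir q A = h * be := vW o1.
have W2 : W o2 = 0.
  by apply: (mulfI h0); rewrite mulr0 -vW.
have prim a b : divides a (b * al) -> divides a (b * be) -> divides a b.
  by move=> ? ?; apply: pW; elim/ord3P => //; rewrite W2 mulr0; exact: divides0.
have be0 : be != 0 by apply: contraNneq Aq0 => e; rewrite AqE e mulr0.
have hal2 : h * al * al = - (be * ddir p B).
  apply: (mulfI h0); transitivity (ddir p A * ddir p A); first by rewrite ApE; ring.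
  by rewrite det AqE; ring.
have [F hF] : divides be h.
  apply: (prim); last by exists h; rewrite mulrC.
  apply: (prim); last by exists (h * al); rewrite mulrC.
  by exists (- ddir p B); rewrite hal2 mulrN.
have beF : be * F != 0 by rewrite -hF.
have F0 : F != 0 by apply: contraNneq beF => ->; rewrite mulr0.
have [|s [les hbe homF]] := @dhomog_factor _ _ (3 - d) _ _ beF; first by rewrite -hF.
have es := dhomog_uniq be0 (hW o1) hbe; rewrite -es in les homF.
have BpE : ddir p B = - (F * al * al).
  by apply: (mulfI be0); rewrite -[LHS]opprK -hal2 hF; ring.
have [d0|d1] : d = 0%N \/ d = 1%N by move: led les; clear; lia.
  have hC i : W i = ((W i)@_0)%:MP by apply: dhomog0E; have := hW i; rewrite d0.
  exists (al@_0), (be@_0); split.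
    by apply/orP; right; apply: contraNneq be0 => e; rewrite /be hC e mpolyC0.
  rewrite !ddirD !ddirZ -!hC -/al -/be BpE BqE ApE AqE hF.
  by split; ring.
have hW1 i : W i \is 1.-homog by have := hW i; rewrite d1.
have homF1 : F \is 1.-homog by have := homF; rewrite d1.
case: (@no_linear_kernel F al be F0 homF1 (hW1 o0) (hW1 o1) be0 prim).
- by rewrite ApE hF; ring.
- by rewrite AqE hF; ring.
- by rewrite BpE.
- by rewrite BqE ApE hF; ring.
Qed.

End NilpotentPair.
End Planar.

(** * Triangularization *)

Section NilpotentMatrix.

Lemma det_mx33 (R : comNzRingType) (A : 'M[R]_3) : \det A = det3 A.
Proof.
rewrite (expand_det_row _ o0) sum3 /cofactor !(expand_det_row _ ord0).
rewrite !big_ord_recl !big_ord0 /cofactor !det_mx11 !mxE /=.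
rewrite /det3 /cofactor3 /dot /cross /=.
pose M (i j : nat) := A (inord i) (inord j).
have AM i j : A i j = M i j by rewrite /M !inord_val.
by rewrite !AM /= /bump /=; ring.
Qed.

(** [X - A] divides [X^k - A^k = X^k]; by determinants, the characteristic polynomial divides a
    power of [X]. *)
Lemma nilpotent_char_poly (F : fieldType) n (A : 'M[F]_n.+1) k :
  A ^+ k = 0 -> char_poly A = 'X^(n.+1).
Proof.
move=> Ak; have : char_poly A %| ('X - 0%:P) ^+ (k * n.+1).
  pose U : 'M[{poly F}]_n.+1 := 'X%:M; pose V := map_mx (@polyC F) A.
  have UV : GRing.comm U V by apply/esym/scalar_mxC.
  have Vk : V ^+ k = 0 by rewrite /V -rmorphXn /= Ak map_mx0.
  have := subrXX_comm k UV; rewrite Vk subr0 => e.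
  have := congr1 determinant e; rewrite det_mulmx -/(char_poly_mx A).
  rewrite /U -rmorphXn /= det_scalar -exprM subr0 => ->.
  exact: dvdp_mulIl.
case/dvdp_exp_XsubCP => m _; rewrite subr0 => e.
have := eqp_size e; rewrite size_char_poly size_polyXn => -[em].
apply/eqP; rewrite -eqp_monic ?char_poly_monic ?monicXn //.
by case: m em e => // m [<-].
Qed.

Lemma nilpotent_invariants (F : fieldType) (A : 'M[F]_3) k : A ^+ k = 0 ->
  [/\ A o0 o0 + A o1 o1 + A o2 o2 = 0,
      cofactor3 A o0 o0 + cofactor3 A o1 o1 + cofactor3 A o2 o2 = 0 &
      det3 A = 0].
Proof.
move=> /nilpotent_char_poly; rewrite /char_poly det_mx33.
set t := _ + _ + _; set s := _ + _ + _.
have -> : det3 (char_poly_mx A) =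
    'X^3 - t *: 'X^2 + s *: 'X - (det3 A)%:P.
  rewrite /t /s /det3 /cofactor3 /dot /cross /= !mxE /= -!mul_polyC.
  by rewrite !(polyCD, polyCB, polyCM, polyCN); ring.
move=> e.
have c2 := congr1 (fun p : {poly F} => p`_2) e.
have c1 := congr1 (fun p : {poly F} => p`_1) e.
have c0 := congr1 (fun p : {poly F} => p`_0) e.
move: c0 c1 c2; rewrite !(coefD, coefB, coefN, coefZ, coefXn, coefX, coefC) /=.
rewrite !(mulr0, mulr1, addr0, add0r, subr0, sub0r, oppr0).
by move=> /eqP; rewrite oppr_eq0 => /eqP -> -> /eqP; rewrite oppr_eq0 => /eqP ->.
Qed.

End NilpotentMatrix.

Section TriangularForms.
Variable K : fieldType.
Hypothesis char2 : 2%:R != 0 :> K.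
Hypothesis char3 : 3%:R != 0 :> K.
Local Notation P := {mpoly K[3]}.
Variable H : 'I_3 -> P.
Let J i := grad (H i).
Hypothesis homH : homog_vec 4 H.
Hypothesis trJ : J o0 o0 + J o1 o1 + J o2 o2 = 0.
Hypothesis minJ : cofactor3 J o0 o0 + cofactor3 J o1 o1 + cofactor3 J o2 o2 = 0.

(** The image of the Jacobian lies in the plane orthogonal to [c], with basis [p], [q]. Its
    restriction to that plane is the planar Jacobian of [H i] and [H j], with the same trace and
    second invariant. The resulting [G] is constant along the plane to first order, so its gradient
    is a multiple of [c]. *)
Lemma triangular_forms : dependent H ->
  exists S : 'M[K]_3, exists phi : P, [/\ S \in unitmx,
    \sum_i S o2 i *: H i = 0 &
    forall l, (\sum_i S o1 i *: H i)^`M(l) = phi * (S o2 l)%:MP].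
Proof.
case=> c [[k ck] cH].
pose nx (i : 'I_3) := match val i with 0 => o1 | 1 => o2 | _ => o0 end.
pose i := nx k; pose j := nx i.
have [s ci] : exists s, c i = s * c k by exists (c i / c k); rewrite mulfVK.
have [t cj] : exists t, c j = t * c k by exists (c j / c k); rewrite mulfVK.
pose p l : K := (l == i)%:R - s * (l == k)%:R.
pose q l : K := (l == j)%:R - t * (l == k)%:R.
pose w l : K := (l == k)%:R.
have perm (F : 'I_3 -> P) : \sum_l F l = F k + F i + F j.
  by rewrite sum3 /j /i; elim/ord3P: (k); rewrite /nx /=; ring.
have ddE (r : 'I_3 -> K) (f : P) : ddir r f =
    (r k)%:MP * f^`M(k) + (r i)%:MP * f^`M(i) + (r j)%:MP * f^`M(j).
  by rewrite -(perm (fun l => (r l)%:MP * f^`M(l))) sum3.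
have [nij [nik njk]] : i == j = false /\ i == k = false /\ j == k = false.
  by rewrite /j /i; elim/ord3P: (k).
have [nji [nki nkj]] : j == i = false /\ k == i = false /\ k == j = false.
  by rewrite !(eq_sym k) (eq_sym j) nij nik njk.
pose neq := (nij, nik, njk, nji, nki, nkj).
pose constE := (mulr0n, mulr1n, mpolyCB, mpolyCM, mpolyC0, mpolyC1).
have pE f : ddir p f = f^`M(i) - s%:MP * f^`M(k).
  by rewrite ddE /p !eqxx !neq !constE; ring.
have qE f : ddir q f = f^`M(j) - t%:MP * f^`M(k).
  by rewrite ddE /q !eqxx !neq !constE; ring.
have wE f : ddir w f = f^`M(k).
  by rewrite ddE /w !eqxx !neq !constE; ring.
have span f : ddir p f = 0 -> ddir q f = 0 -> ddir w f = 0 ->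
    forall l, f^`M(l) = 0.
  rewrite pE qE wE => pf qf wf; rewrite wf !mulr0 !subr0 in pf qf.
  by move: pf qf wf; rewrite /j /i; elim/ord3P: (k) => /= ???; elim/ord3P.
have Hk : H k = - (s%:MP * H i + t%:MP * H j).
  have ckP : (c k)%:MP != 0 :> P by rewrite mpolyC_eq0.
  apply: (mulfI ckP); apply/eqP; rewrite -subr_eq0 -cH perm ci cj -!mul_mpolyC !mpolyCM.
  by apply/eqP; ring.
have HkD l : (H k)^`M(l) = - (s%:MP * (H i)^`M(l) + t%:MP * (H j)^`M(l)).
  by rewrite Hk mderivN mderivD !mderiv_mulC.
have tr : ddir p (H i) + ddir q (H j) = 0.
  transitivity ((H k)^`M(k) + (H i)^`M(i) + (H j)^`M(j)).
    by rewrite pE qE HkD; ring.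
  by rewrite -(perm (fun l => (H l)^`M(l))) sum3.
have det : ddir p (H i) * ddir q (H j) = ddir q (H i) * ddir p (H j).
  apply/eqP; rewrite -subr_eq0 -minJ !pE !qE; apply/eqP.
  transitivity
    ((H i)^`M(i) * (H j)^`M(j) - (H i)^`M(j) * (H j)^`M(i)
   + ((H i)^`M(i) * (H k)^`M(k) - (H i)^`M(k) * (H k)^`M(i))
   + ((H k)^`M(k) * (H j)^`M(j) - (H k)^`M(j) * (H j)^`M(k))).
    by rewrite !HkD; ring.
  rewrite /cofactor3 /cross /J /grad /j /i; elim/ord3P: (k) => /=; ring.
have [y [z [yz [Gp Gq]]]] := nilpotent_pair char2 char3 span (homH i) tr det.
pose G := y *: H i + z *: H j.
pose b l : K := y * (l == i)%:R + z * (l == j)%:R.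
(* A unit vector completing [b] and [c] to a basis; the determinant is, up to sign, [y] or [z] times
   [c k]. *)
pose a l : K := if y != 0 then (l == j)%:R else (l == i)%:R.
pose S : 'M[K]_3 := \matrix_(r, l) match val r with 0 => a l | 1 => b l | _ => c l end.
exists S, ((c k)^-1 *: G^`M(k)); split.
- rewrite unitmxE unitfE det_mx33.
  have -> : det3 S = a k * (b i * c j - b j * c i)
     + a i * (b j * c k - b k * c j) + a j * (b k * c i - b i * c k).
    rewrite /det3 /cofactor3 /dot /cross /= !mxE /= /j /i.
    by elim/ord3P: (k) => /=; ring.
  have -> : b k = 0 by rewrite /b !neq !mulr0n !mulr0 addr0.
  have -> : a k = 0 by rewrite /a !neq; case: (y != 0).
  rewrite !(mul0r, subr0, sub0r, add0r) /a /b !eqxx !neq.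
  have [y0|y0] := eqVneq y 0; last first.
    by rewrite /= !(mul0r, mulr0, mul1r, mulr1, addr0, add0r) oppr_eq0 mulf_neq0.
  rewrite y0 eqxx in yz.
  by rewrite /= !(mul0r, mulr0, mul1r, mulr1, addr0, add0r) mulf_neq0.
- transitivity (\sum_l c l *: H l) => //.
  by apply: eq_bigr => l _; rewrite mxE.
- move=> l; have -> : \sum_m S o1 m *: H m = G.
    transitivity (\sum_m b m *: H m); first by apply: eq_bigr => m _; rewrite mxE.
    rewrite perm /b !eqxx !neq.
    by rewrite !(mulr0, mulr1, addr0, add0r) scale0r add0r.
  have -> : S o2 l = c l by rewrite mxE.
  have ckP : (c k)^-1%:MP * (c k)%:MP = 1 :> P by rewrite -mpolyCM mulVf.
  rewrite -mul_mpolyC; move: ((c k)^-1%:MP) ckP => ic ckP.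
  move: Gp Gq; rewrite -/G pE qE => /subr0_eq Gi /subr0_eq Gj.
  have gi : G^`M(i) = ic * G^`M(k) * (c i)%:MP.
    by rewrite Gi ci mpolyCM -[LHS]mul1r -ckP; ring.
  have gj : G^`M(j) = ic * G^`M(k) * (c j)%:MP.
    by rewrite Gj cj mpolyCM -[LHS]mul1r -ckP; ring.
  have gk : G^`M(k) = ic * G^`M(k) * (c k)%:MP.
    by rewrite -[LHS]mul1r -ckP; ring.
  move: gi gj gk; rewrite /j /i; elim/ord3P: (k) => /= ???; by elim/ord3P: l.
Qed.

End TriangularForms.

(** * Rank and transcendence degree *)

Section LeadingMonomials.
Variables (K : fieldType) (n d : nat) (F : 'I_d -> {mpoly K[n]}).
Hypothesis F0 : forall i, F i != 0.

Definition lead_exponent (m : 'X_{1..d}) := (\sum_(i < d) mlead (F i) *+ m i)%MM.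

Lemma mlead_prod_expr (m : 'X_{1..d}) :
  mlead (\prod_(i < d) F i ^+ m i) = lead_exponent m.
Proof.
rewrite mlead_prod => [|i _ _]; last by rewrite expf_neq0.
by apply: eq_bigr => i _; rewrite mleadX.
Qed.

Lemma seq_max (T : eqType) (f : T -> 'X_{1..n}) (s : seq T) : s != [::] ->
  exists2 x, x \in s & forall y, y \in s -> (f y <= f x)%O.
Proof.
elim: s => // a [|b s] IHs _.
  by exists a; rewrite ?mem_head // => y; rewrite inE => /eqP ->.
have [//|x xs xmax] := IHs.
have [ax|xa] := leP (f a) (f x).
  exists x; first by rewrite inE xs orbT.
  by move=> y; rewrite inE => /predU1P[->|/xmax].
exists a; first exact: mem_head.
move=> y; rewrite inE => /predU1P[->|/xmax yx] //.
exact: le_trans yx (ltW xa).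
Qed.

(** Distinct monomials in the [F i] have distinct leading monomials, so the largest one cannot
    cancel. *)
Lemma alg_independent_lead : injective lead_exponent ->
  alg_independent (@ratfunC K n) (fun i => tofrac (F i)).
Proof.
move=> inj p; pose M (m : 'X_{1..d}) := \prod_(i < d) F i ^+ m i.
have M0 m : M m != 0 by apply/prodf_neq0 => i _; rewrite expf_neq0.
have -> : mmap (@ratfunC K n) (fun i => tofrac (F i)) p =
    tofrac (\sum_(m <- msupp p) p@_m *: M m).
  rewrite rmorph_sum; apply: eq_bigr => m _.
  rewrite -mul_mpolyC rmorphM; congr (_ * _).
  by rewrite /mmap1 rmorph_prod; apply: eq_bigr => i _; rewrite rmorphXn.
move/eqP; rewrite tofrac_eq0 => /eqP q0.
apply/eqP; apply: contraT => p0.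
have [|m mp mmax] := seq_max lead_exponent (s := msupp p).
  by rewrite msupp_eq0.
have := congr1 (mcoeff (lead_exponent m)) q0.
rewrite raddf_sum mcoeff0 (bigD1_seq m) //= big_seq_cond big1 => [|m' /andP[mp' ne]].
  rewrite addr0 mcoeffZ -mlead_prod_expr => /eqP.
  by rewrite mulf_eq0 mleadc_eq0 (negbTE (M0 m)) orbF mcoeff_eq0 mp.
rewrite mcoeffZ [_@_(lead_exponent m)]mcoeff_gt_mlead ?mulr0 // mlead_prod_expr.
by rewrite lt_neqAle mmax // (inj_eq inj) ne.
Qed.

End LeadingMonomials.

Section Adjoin.
Variables (K L : fieldType) (iota : {rmorphism K -> L}).

Lemma adjoin_sub (S S' : L -> Prop) : (forall b, S b -> adjoin iota S' b) ->
  forall b, adjoin iota S b -> adjoin iota S' b.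
Proof.
move=> SS' b; elim=> {b} [c|b|a b _ ha _ hb|a _ ha|a b _ ha _ hb|a _ ha].
- exact: adjoin_base.
- exact: SS'.
- exact: adjoin_add.
- exact: adjoin_opp.
- exact: adjoin_mul.
- exact: adjoin_inv.
Qed.

Lemma adjoin_comb m (S : L -> Prop) (c : 'I_m -> K) (a : 'I_m -> L) :
  (forall i, S (a i)) -> adjoin iota S (\sum_i iota (c i) * a i).
Proof.
move=> Sa; apply: big_ind => [|x y|i _]; [|exact: adjoin_add|].
  by rewrite -(rmorph0 iota); exact: adjoin_base.
by apply: adjoin_mul; [exact: adjoin_base | exact/adjoin_gen].
Qed.

Lemma algebraic_self (S : L -> Prop) b :
  adjoin iota S b -> algebraic_over (adjoin iota S) b.
Proof.
move=> Sb; exists ('X - b%:P); split; last by rewrite root_XsubC.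
  by rewrite polyXsubC_eq0.
have [a0 a1] : adjoin iota S 0 /\ adjoin iota S 1.
  by rewrite -(rmorph0 iota) -(rmorph1 iota); split; exact: adjoin_base.
case=> [|[|i]]; rewrite coefB coefX coefC /= ?sub0r ?subr0 ?oppr0 //.
exact: adjoin_opp.
Qed.

End Adjoin.

Section Span.
Variables (K : fieldType) (n : nat).
Local Notation P := {mpoly K[n]}.

Lemma jacobian_comb m d (H : 'I_m -> P) (F : 'I_d -> P) (C : 'M[K]_(m, d)) :
  (forall i, H i = \sum_j C i j *: F j) ->
  jacobian H = map_mx (@ratfunC K n) C *m jacobian F.
Proof.
move=> HF; apply/matrixP => i l; rewrite !mxE HF (raddf_sum (mderiv l)) rmorph_sum.
apply: eq_bigr => j _; rewrite !mxE /= mderivZ -mul_mpolyC rmorphM //.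
Qed.

Definition in_span m (H : 'I_m -> P) (f : P) :=
  exists c : 'I_m -> K, f = \sum_i c i *: H i.

Lemma in_spanD m (H : 'I_m -> P) f g :
  in_span H f -> in_span H g -> in_span H (f + g).
Proof.
move=> [a ->] [b ->]; exists (fun i => a i + b i).
by rewrite -big_split; apply: eq_bigr => i _; rewrite scalerDl.
Qed.

Lemma in_spanZ m (H : 'I_m -> P) a f : in_span H f -> in_span H (a *: f).
Proof.
move=> [b ->]; exists (fun i => a * b i).
by rewrite scaler_sumr; apply: eq_bigr => i _; rewrite scalerA.
Qed.

Lemma in_span_gen m (H : 'I_m -> P) i : in_span H (H i).
Proof.
exists (fun j => (j == i)%:R); rewrite (bigD1 i) //= eqxx scale1r.
by rewrite big1 ?addr0 // => j /negbTE ->; rewrite scale0r.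
Qed.

Lemma in_span_matrix m d (H : 'I_m -> P) (F : 'I_d -> P) :
  (forall i, in_span F (H i)) ->
  exists C : 'M[K]_(m, d), forall i, H i = \sum_j C i j *: F j.
Proof.
move=> HF; have [c HcF] := fin_all_exists HF.
exists (\matrix_(i, j) c i j) => i; rewrite HcF.
by apply: eq_bigr => j _; rewrite mxE.
Qed.

(** Both numbers equal [d]: each Jacobian is a constant matrix times the other, and the components
    of [H] and of [F] generate the same field. *)
Lemma trdeg_rank_span m d (H : 'I_m -> P) (F : 'I_d -> P) :
  (forall i, in_span F (H i)) -> (forall j, in_span H (F j)) ->
  alg_independent (@ratfunC K n) (fun i => tofrac (F i)) ->
  row_free (jacobian F) ->
  is_trdeg (@ratfunC K n)
    (adjoin_family (@ratfunC K n) (fun i => tofrac (H i))) (\rank (jacobian H)).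
Proof.
move=> /in_span_matrix[C HF] /in_span_matrix[D FH] indep free.
have toE k l (G : 'I_k -> P) (B : 'M[K]_(l, k)) i :
    tofrac (\sum_j B i j *: G j) = \sum_j ratfunC n (B i j) * tofrac (G j).
  by rewrite rmorph_sum; apply: eq_bigr => j _; rewrite -mul_mpolyC rmorphM.
have -> : \rank (jacobian H) = d.
  apply/eqP; rewrite eqn_leq; apply/andP; split.
    rewrite (jacobian_comb HF); apply: leq_trans (mxrankM_maxr _ _) _.
    exact: rank_leq_row.
  rewrite -(eqP free) [in X in (X <= _)%N](jacobian_comb FH).
  exact: mxrankM_maxr.
exists (fun i => tofrac (F i)); split=> // [j|b Hb].
  by rewrite FH toE; apply: adjoin_comb => i; exists i.
apply: algebraic_self; apply: adjoin_sub Hb => _ [i ->].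
by rewrite HF toE; apply: adjoin_comb => j; exists j.
Qed.

(** Gaussian elimination on leading monomials, preparing for [alg_independent_lead]. *)
Lemma echelon2 (f g : P) :
  [\/ f = 0 /\ g = 0,
      exists F, [/\ F != 0, exists a b, F = a *: f + b *: g &
        exists c e, f = c *: F /\ g = e *: F] |
      exists a, [/\ f != 0, g - a *: f != 0 & mlead f != mlead (g - a *: f)]].
Proof.
have [->|f0] := eqVneq f 0.
  have [->|g0] := eqVneq g 0; first by constructor 1.
  constructor 2; exists g; split=> //; [exists 0, 1 | exists 0, 1].
    by rewrite scale0r scale1r add0r.
  by rewrite scale0r scale1r.
have lf : mleadc f != 0 by rewrite mleadc_eq0.
pose a := g@_(mlead f) / mleadc f.
have [ga|ga] := eqVneq (g - a *: f) 0.
  constructor 2; exists f; split=> //; [exists 1, 0 | exists 1, a].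
    by rewrite scale1r scale0r addr0.
  by rewrite scale1r; split=> //; apply: subr0_eq.
constructor 3; exists a; split=> //.
have e0 : (g - a *: f)@_(mlead f) = 0 by rewrite mcoeffB mcoeffZ mulfVK ?subrr.
by apply: contraNneq ga => e; rewrite -mleadc_eq0 -e e0.
Qed.

End Span.

(** * Independence in spans of quartic forms *)

Section QuarticSpan.
Variable K : fieldType.
Hypothesis char2 : 2%:R != 0 :> K.
Hypothesis char3 : 3%:R != 0 :> K.
Local Notation P := {mpoly K[3]}.

Lemma mlead_homog n d (f : {mpoly K[n]}) : f != 0 -> f \is d.-homog ->
  mdeg (mlead f) = d.
Proof. by move=> f0 /dhomogP hf; apply: hf; exact: mlead_supp. Qed.

Section Pair.
Variables f g : P.
Hypothesis homf : f \is 4.-homog.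
Hypothesis homg : g \is 4.-homog.
Hypothesis f0 : f != 0.
Hypothesis g0 : g != 0.
Hypothesis fg : mlead f != mlead g.

Definition pair_family (i : 'I_2) := if val i == 0%N then f else g.

Lemma pair_family_neq0 i : pair_family i != 0.
Proof. by rewrite /pair_family; case: ifP. Qed.

(** The two leading exponents differ but both have degree 4. So the total degree fixes the sum of
    the entries of [m], and a coordinate where the exponents differ fixes each entry. *)
Lemma pair_lead_inj : injective (lead_exponent pair_family).
Proof.
move=> m m'; rewrite /lead_exponent !big_ord_recl !big_ord0 /pair_family /=.
set i1 := lift _ _ => e.
have deg : (4 * m ord0 + 4 * m i1 = 4 * m' ord0 + 4 * m' i1)%N.
  have := congr1 mdeg e; rewrite !addm0 !mdegD !mdegMn.
  by rewrite !(mlead_homog f0 homf) !(mlead_homog g0 homg).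
have [l fgl] : exists l, mlead f l != mlead g l.
  apply/existsP; apply: contraNT fg; rewrite negb_exists => /forallP e'.
  by apply/eqP/mnmP => l; apply/eqP; rewrite -[_ == _]negbK.
have := congr1 (fun m : 'X_{1..3} => m l) e; rewrite !addm0 !mnmDE !mulmnE.
move: (mlead f l) (mlead g l) fgl => a b; move=> ab e'.
have [e0 e1] : m ord0 = m' ord0 /\ m i1 = m' i1.
  move: (m ord0) (m' ord0) (m i1) (m' i1) deg e' ab; clear => x x' y y' deg e' ab.
  have : (x = x')%N by nia.
  by move=> ?; split=> //; lia.
apply/mnmP => i; case: (unliftP ord0 i) => [k|] -> //.
by rewrite (ord1 k).
Qed.

(** In characteristic p a quotient with zero derivatives need not be constant; the degree 4 makes it
    so here, through [parallel_derivs_const], and then the leading monomials would agree. *)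
Lemma pair_not_proportional : ~ (forall l, f * g^`M(l) = g * f^`M(l)).
Proof.
move=> e.
pose v (i : 'I_3) : P := match val i with 0 => f | 1 => g | _ => 0 end.
have hv : homog_vec 4 v by elim/ord3P => //=; exact: dhomog0.
have [|l|h [gam [_ vE]]] := parallel_derivs_const char2 char3 (leqnn 4) hv.
- by exists o0.
- have z : mderiv l (0 : P) = 0 by exact: mderiv0.
  by elim/ord3P; elim/ord3P; rewrite /pderiv /= ?z ?mul0r ?mulr0 // mulrC.
have fE : f = gam o0 *: h by rewrite -mul_mpolyC mulrC -(vE o0).
have gE : g = gam o1 *: h by rewrite -mul_mpolyC mulrC -(vE o1).
have c0 : gam o0 != 0 by apply: contraNneq f0 => c; rewrite fE c scale0r.
have c1 : gam o1 != 0 by apply: contraNneq g0 => c; rewrite gE c scale0r.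
by case/eqP: fg; rewrite fE gE !mleadZ.
Qed.

(** Euler's formula adds [a f + b g = 0] to a relation between the gradients; the resulting system
    has determinant [f d_l g - g d_l f], nonzero for some [l]. *)
Lemma pair_row_free : row_free (jacobian pair_family).
Proof.
rewrite -kermx_eq0; apply/rowV0P => v /sub_kermxP vJ.
pose a := v ord0 ord0; pose b := v ord0 (lift ord0 ord0).
have vE l : a * tofrac (f^`M(l)) + b * tofrac (g^`M(l)) = 0.
  by have /matrixP/(_ ord0 l) := vJ; rewrite !mxE !big_ord_recl big_ord0 addr0 !mxE.
have eul : a * tofrac f + b * tofrac g = 0.
  have four : tofrac (4%:R : P) != 0 by rewrite tofrac_eq0 natP_neq0 // char_small.
  apply: (mulfI four); rewrite mulr0.
  transitivity (a * tofrac (4%:R * f) + b * tofrac (4%:R * g)).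
    by rewrite !rmorphM /=; ring.
  rewrite -(euler_dot homf) -(euler_dot homg) /dot /grad !rmorphD !rmorphM /=.
  transitivity
    (\sum_l tofrac (xvec K l) * (a * tofrac (f^`M(l)) + b * tofrac (g^`M(l)))).
    by rewrite sum3; ring.
  by rewrite big1 // => l _; rewrite vE mulr0.
have w l : a * tofrac (f * g^`M(l) - g * f^`M(l)) = 0
    /\ b * tofrac (f * g^`M(l) - g * f^`M(l)) = 0.
  rewrite rmorphB !rmorphM /=; split.
    transitivity (tofrac (g^`M(l)) * (a * tofrac f + b * tofrac g)
      - tofrac g * (a * tofrac (f^`M(l)) + b * tofrac (g^`M(l)))); first by ring.
    by rewrite eul vE !mulr0 subrr.
  transitivity (tofrac f * (a * tofrac (f^`M(l)) + b * tofrac (g^`M(l)))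
    - tofrac (f^`M(l)) * (a * tofrac f + b * tofrac g)); first by ring.
  by rewrite eul vE !mulr0 subrr.
have [/forallP e|] := boolP [forall l, f * g^`M(l) == g * f^`M(l)].
  by case: pair_not_proportional => l; apply/eqP/e.
rewrite negb_forall => /existsP[l nl].
have nz : tofrac (f * g^`M(l) - g * f^`M(l)) != 0 by rewrite tofrac_eq0 subr_eq0.
have [wa wb] := w l.
have a0 : a = 0 by apply: (mulIf nz); rewrite wa mul0r.
have b0 : b = 0 by apply: (mulIf nz); rewrite wb mul0r.
apply/rowP => i; rewrite mxE; case: (unliftP ord0 i) => [k|] -> //.
by rewrite (ord1 k).
Qed.

End Pair.

Lemma single_row_free (F : P) : F \is 4.-homog -> F != 0 ->
  row_free (jacobian (fun _ : 'I_1 => F)).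
Proof.
move=> hF F0; rewrite /row_free rank_rV.
have [J0|] := eqVneq (jacobian _) 0; last by [].
case/eqP: F0; apply: (@mulr_natP K 4); first exact: char_small.
rewrite -euler_dot //; apply: dot_eq0 => l; apply/eqP.
rewrite -tofrac_eq0; apply/eqP.
by have /matrixP/(_ ord0 l) := J0; rewrite !mxE.
Qed.

Lemma trdeg_dependent (H : 'I_3 -> P) : homog_vec 4 H -> dependent H ->
  is_trdeg (@ratfunC K 3)
    (adjoin_family (@ratfunC K 3) (fun i => tofrac (H i))) (\rank (jacobian H)).
Proof.
move=> homH [c [[k ck] cH]].
have [i [j Hij]] : exists i j, forall m, exists a b, H m = a *: H i + b *: H j.
  pose nx (i : 'I_3) := match val i with 0 => o1 | 1 => o2 | _ => o0 end.
  exists (nx k), (nx (nx k)) => m.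
  have Hk : H k = - ((c k)^-1 *:
      (c (nx k) *: H (nx k) + c (nx (nx k)) *: H (nx (nx k)))).
    apply: (scalerI ck); rewrite scalerN scalerA divff // scale1r.
    apply/eqP; rewrite -addr_eq0 -cH sum3; apply/eqP.
    by rewrite -!mul_mpolyC; elim/ord3P: (k); rewrite /nx /=; ring.
  have [->|[->|->]] : m = k \/ m = nx k \/ m = nx (nx k).
    by move: m; elim/ord3P: (k); elim/ord3P; rewrite /nx /=; tauto.
  - exists (- ((c k)^-1 * c (nx k))), (- ((c k)^-1 * c (nx (nx k)))).
    by rewrite {1}Hk scalerDr !scalerA opprD !scaleNr.
  - by exists 1, 0; rewrite scale1r scale0r addr0.
  - by exists 0, 1; rewrite scale1r scale0r add0r.
have span d (F : 'I_d -> P) : in_span F (H i) -> in_span F (H j) ->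
    forall m, in_span F (H m).
  move=> hi hj m; have [a [b ->]] := Hij m.
  by apply: in_spanD; apply: in_spanZ.
case: (echelon2 (H i) (H j)) =>
  [[Hi Hj]|[F [F0 [a [b FE]] [x [y [Hi Hj]]]]]|[a [Hi0 g0 lead]]].
- apply: (@trdeg_rank_span _ _ _ 0 _ (fun=> 0)).
  + by apply: span; rewrite ?Hi ?Hj; exists (fun=> 0); rewrite big_ord0.
  + by case.
  + by apply: alg_independent_lead => [[]//|m m' _]; apply/mnmP; case.
  + by rewrite /row_free -leqn0 rank_leq_row.
- have homF : F \is 4.-homog.
    by rewrite FE; apply: rpredD; apply: rpredZ; apply: homH.
  apply: (@trdeg_rank_span _ _ _ 1 _ (fun=> F)).
  + apply: span; rewrite ?Hi ?Hj; apply: in_spanZ; exact: (in_span_gen _ ord0).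
  + by move=> _; rewrite FE; apply: in_spanD; apply: in_spanZ; exact: in_span_gen.
  + apply: alg_independent_lead => // m m'; rewrite /lead_exponent !big_ord1 => e.
    apply/mnmP => l; rewrite (ord1 l); have := congr1 mdeg e.
    rewrite !mdegMn (mlead_homog F0 homF) => /eqP.
    by rewrite eqn_pmul2l // => /eqP.
  + exact: single_row_free.
- set g := H j - a *: H i in g0 lead.
  have homg : g \is 4.-homog by apply: dhomogB => //; apply: rpredZ; apply: homH.
  pose F := pair_family (H i) g.
  have Fi : in_span F (H i) by exact: (in_span_gen F ord0).
  have Fg : in_span F g by exact: (in_span_gen F (lift ord0 ord0)).
  apply: (@trdeg_rank_span _ _ _ 2 _ F).
  + apply: span => //; rewrite -[H j](subrK (a *: H i)) -/g.
    by apply: in_spanD => //; exact: in_spanZ.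
  + move=> l; rewrite /F /pair_family; case: ifP => _; first exact: in_span_gen.
    rewrite /g -scaleNr; apply: in_spanD; first exact: in_span_gen.
    by apply: in_spanZ; exact: in_span_gen.
  + apply: alg_independent_lead; first exact: pair_family_neq0.
    exact: pair_lead_inj.
  + exact: pair_row_free.
Qed.

End QuarticSpan.

(** * From the Jacobian matrix to polynomial identities and back *)

Section Jacobian.
Variables (K : fieldType) (H : 'I_3 -> {mpoly K[3]}).
Local Notation JH := (jacobian H).
Let J i := grad (H i).

Lemma jacobian_invariants k : JH ^+ k = 0 ->
  [/\ J o0 o0 + J o1 o1 + J o2 o2 = 0,
      cofactor3 J o0 o0 + cofactor3 J o1 o1 + cofactor3 J o2 o2 = 0 &
      det3 J = 0].
Proof.
have JE i l : JH i l = tofrac (J i l) by rewrite mxE.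
have cofE r l : cofactor3 JH r l = tofrac (cofactor3 J r l).
  by elim/ord3P: r; elim/ord3P: l; rewrite /cofactor3 /cross /= !JE rmorphB !rmorphM.
case/nilpotent_invariants => t s d; split; apply/eqP; rewrite -tofrac_eq0; apply/eqP.
- by rewrite -[RHS]t !JE !rmorphD.
- by rewrite -[RHS]s !cofE !rmorphD.
- by rewrite -[RHS]d /det3 /dot !cofE !JE; ring.
Qed.

Lemma row_mul_jacobian (S : 'M[K]_3) r l :
  (map_mx (@ratfunC K 3) S *m JH) r l =
  tofrac ((\sum_m S r m *: H m)^`M(l)).
Proof.
rewrite mxE (raddf_sum (mderiv l)) rmorph_sum; apply: eq_bigr => m _.
by rewrite !mxE /= mderivZ -mul_mpolyC rmorphM.
Qed.

(** In [S JH S^-1] the last row vanishes, and the middle row is [phi] times the last row of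
    [S S^-1 = 1]. The result is upper triangular, whence the transpose. *)
Lemma jacobian_triangular (S : 'M[K]_3) (phi : {mpoly K[3]}) :
  S \in unitmx -> \sum_i S o2 i *: H i = 0 ->
  (forall l, (\sum_i S o1 i *: H i)^`M(l) = phi * (S o2 l)%:MP) ->
  exists2 M : 'M[ratfun K 3]_3, triangular_mx M & similar_over JH M.
Proof.
move=> Su S2 S1; pose f := @ratfunC K 3; pose T := invmx S.
exists (map_mx f S *m JH *m map_mx f T); last first.
  by exists T; rewrite ?unitmx_inv // -map_invmx /T invmxK.
have ST : map_mx f S *m map_mx f T = 1%:M by rewrite -map_mxM mulmxV // map_mx1.
have row2 l : (map_mx f S *m JH *m map_mx f T) o2 l = 0.
  rewrite mxE big1 // => m _.
  by rewrite row_mul_jacobian S2 mderiv0 rmorph0 mul0r.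
have row1 l : (map_mx f S *m JH *m map_mx f T) o1 l = tofrac phi * (o2 == l)%:R.
  rewrite mxE; transitivity (tofrac phi * (map_mx f S *m map_mx f T) o2 l).
    rewrite mxE mulr_sumr; apply: eq_bigr => m _.
    by rewrite row_mul_jacobian S1 rmorphM mulrA [map_mx f S o2 m]mxE.
  by rewrite ST mxE.
apply/orP; right; apply/is_trig_mxP => i j ij; rewrite mxE.
by elim/ord3P: i ij; elim/ord3P: j => // _; rewrite ?row2 // row1 mulr0.
Qed.

End Jacobian.

Theorem theorem6p1 (K : fieldType) (H : 'I_3 -> {mpoly K[3]})
    (hchar2 : 2%N \notin [pchar K]) (hchar3 : 3%N \notin [pchar K])
    (hhomog : forall i, H i \is 4.-homog)
    (hnil : exists k : nat, jacobian H ^+ k = 0) :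
  (exists2 M : 'M[ratfun K 3]_3,
     triangular_mx M & similar_over (jacobian H) M)
  /\ is_trdeg (@ratfunC K 3)
       (adjoin_family (@ratfunC K 3) (fun i => tofrac (H i)))
       (\rank (jacobian H)).
Proof.
have char2 : 2%:R != 0 :> K by move: hchar2; rewrite inE.
have char3 : 3%:R != 0 :> K by move: hchar3; rewrite inE.
have [k /jacobian_invariants[trJ minJ detJ]] := hnil.
have dep := dependent_of_char_poly char2 char3 hhomog trJ minJ detJ.
split; last exact: trdeg_dependent.
have [S [phi [Su S2 S1]]] :=
  triangular_forms char2 char3 hhomog trJ minJ dep.
exact: jacobian_triangular Su S2 S1.
Qed.
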